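(* Let $\gamma:[0,\ell_\gamma]\to\mathbb R$ be a normalised profile function. There exists a unique one-form $\beta^\gamma$ on $S^2_\gamma$ with $d\beta^\gamma=(1-K)\mu_\gamma$ that can be written in the form $\beta^\gamma=\beta^\gamma_\theta(t)\,d\theta$. It satisfies $m_\gamma=\|\beta^\gamma\|$. Moreover $\beta^\gamma_\theta=\Gamma+\dot\gamma$ and $$\|\beta^\gamma\|=\sup_{t\in[0,\ell_\gamma]}\left|\frac{\Gamma(t)+\dot\gamma(t)}{\gamma(t)}\right|.$$
   Context: A normalised profile function is a smooth $\gamma:[0,\ell_\gamma]\to\mathbb R$ such that: $\gamma(0)=\gamma(\ell_\gamma)=0$ and $\gamma>0$ on $(0,\ell_\gamma)$; $\dot\gamma(0)=1$, $\dot\gamma(\ell_\gamma)=-1$ and $|\dot\gamma|<1$ on $(0,\ell_\gamma)$; all even derivatives of $\gamma$ vanish at $0$ and $\ell_\gamma$; $\int_0^{\ell_\gamma}\gamma\,dt=2$. The surface of revolution $S^2_\gamma$ is the quotient of $[0,\ell_\gamma]\times\mathbb R/2\pi\mathbb Z$ (coordinates $(t,\theta)$) collapsing each boundary circle to a point (a pole), with metric $g_\gamma=dt^2+\gamma(t)^2d\theta^2$, area form $\mu_\gamma=\gamma\,dt\wedge d\theta$ and Gaussian curvature $K=-\ddot\gamma/\gamma$. $\Gamma:[0,\ell_\gamma]\to[-1,1]$ is the primitive of $\gamma$ with $\Gamma(0)=-1$ (so $\Gamma(\ell_\gamma)=1$). The norm of a one-form is $\|\beta\|=\sup_x|\beta_x|_{g_\gamma}$,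 and $m_\gamma:=\inf\{\|\beta\|:\beta\in\Omega^1(S^2_\gamma),\ d\beta=(1-K)\mu_\gamma\}$. At $t=0,\ell_\gamma$ the quotient $(\Gamma+\dot\gamma)/\gamma$ is understood as its continuous extension. *)

(* Defs.v *)
From Stdlib Require Import Reals.
From Coquelicot Require Import Coquelicot.

Open Scope R_scope.

(** A normalised profile function, bundled with its successive derivatives.
    Smoothness on the closed interval is intrinsic: [dgam p n] is the n-th
    derivative relative to [0, ell], hence one-sided at the end points.  Values
    outside [0, ell] carry no information and are never used. *)
Record profile := Profile {
  ell : R;
  dgam : nat -> R -> R;
  ell_pos : 0 < ell;
  dgam_deriv : forall (n : nat) (t : R), 0 <= t <= ell ->
    D_in (dgam n) (dgam (S n)) (fun s => 0 <= s <= ell) t;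
  gam_0 : dgam 0 0 = 0;
  gam_ell : dgam 0 ell = 0;
  gam_pos : forall t : R, 0 < t < ell -> 0 < dgam 0 t;
  dgam_0 : dgam 1 0 = 1;
  dgam_ell : dgam 1 ell = -1;
  dgam_lt1 : forall t : R, 0 < t < ell -> Rabs (dgam 1 t) < 1;
  dgam_even_0 : forall k : nat, dgam (2 * k) 0 = 0;
  dgam_even_ell : forall k : nat, dgam (2 * k) ell = 0;
  gam_int : RInt (dgam 0) 0 ell = 2
}.

Definition gam (g : profile) : R -> R := dgam g 0.

Definition Gam (g : profile) (t : R) : R := -1 + RInt (gam g) 0 t.

(** The extension to [0, ell] of a function on (0, ell) by its one-sided
    limits at the end points. *)
Definition cont_ext (g : profile) (f : R -> R) (t : R) : R :=
  if Rle_dec t 0 then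
    iota (fun y : R => filterlim f (at_right 0) (locally y))
  else if Rle_dec (ell g) t then
    iota (fun y : R => filterlim f (at_left (ell g)) (locally y))
  else f t.

(** Gaussian curvature, as a function of the coordinate t. *)
Definition curv (g : profile) : R -> R :=
  cont_ext g (fun t => - dgam g 2 t / gam g t).

(** The smooth structure of the surface of revolution is given by two charts,
    one around each pole, both with the open disc of radius ell as domain.  The
    point (r cos th, r sin th) of the chart around the pole t = 0 (resp.
    t = ell) stands for the class of (r, th) (resp. (ell - r, th)) in the
    quotient of [0, ell] x R/2piZ; the origin is the pole itself.  Each chart
    covers everything but the opposite pole, and the charts overlap in the
    cylinder 0 < t < ell. *)
Inductive pole := North | South.

Definition radius (x y : R) : R := sqrt (x ^ 2 + y ^ 2).

Definition in_chart (g : profile) (x y : R) : Prop := radius x y < ell g.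

(** Exchanges the coordinate t and the radius in the chart. *)
Definition flip (g : profile) (p : pole) (r : R) : R :=
  match p with North => r | South => ell g - r end.

(** dt = orient p * dr in the chart around p. *)
Definition orient (p : pole) : R :=
  match p with North => 1 | South => -1 end.

Definition smooth_on_chart (g : profile) (f : R -> R -> R) : Prop :=
  forall x y : R, in_chart g x y -> forall n : nat, ex_diff_n f n x y.

(** Components along dt and dtheta, at (t, th) with 0 < t < ell, of the form
    P dx + Q dy given in the chart around p. *)
Definition dt_comp (g : profile) (p : pole) (P Q : R -> R -> R) (t th : R) : R :=
  let x := flip g p t * cos th in
  let y := flip g p t * sin th in
  orient p * (P x y * cos th + Q x y * sin th).

Definition dtheta_comp (g : profile) (p : pole) (P Q : R -> R -> R) (t th : R) : R :=
  let x := flip g p t * cos th in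
  let y := flip g p t * sin th in
  flip g p t * (Q x y * cos th - P x y * sin th).

(** Smooth one-forms on the surface: a smooth form [form_x p dx + form_y p dy]
    in each chart, such that both agree on the overlap. *)
Record one_form (g : profile) := OneForm {
  form_x : pole -> R -> R -> R;
  form_y : pole -> R -> R -> R;
  form_x_smooth : forall p : pole, smooth_on_chart g (form_x p);
  form_y_smooth : forall p : pole, smooth_on_chart g (form_y p);
  form_glue : forall t th : R, 0 < t < ell g ->
    dt_comp g North (form_x North) (form_y North) t th =
      dt_comp g South (form_x South) (form_y South) t th /\
    dtheta_comp g North (form_x North) (form_y North) t th =
      dtheta_comp g South (form_x South) (form_y South) t th
}.

Arguments form_x {g} _ _ _ _.
Arguments form_y {g} _ _ _ _.

(** Equality at every point of the surface; values of the coefficients outside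
    the charts are irrelevant. *)
Definition form_eq {g : profile} (b b' : one_form g) : Prop :=
  forall (p : pole) (x y : R), in_chart g x y ->
    form_x b p x y = form_x b' p x y /\ form_y b p x y = form_y b' p x y.

(** b = f(t) dtheta. *)
Definition is_dtheta_form {g : profile} (b : one_form g) (f : R -> R) : Prop :=
  forall (p : pole) (t th : R), 0 < t < ell g ->
    dt_comp g p (form_x b p) (form_y b p) t th = 0 /\
    dtheta_comp g p (form_x b p) (form_y b p) t th = f t.

(** Coefficient of dx /\ dy in the exterior derivative. *)
Definition ext_d {g : profile} (b : one_form g) (p : pole) (x y : R) : R :=
  Derive (fun z => form_y b p z y) x - Derive (fun z => form_x b p x z) y.

(** Coefficient of dx /\ dy in the area form gam dt /\ dtheta; recall that
    dr /\ dtheta = r^-1 dx /\ dy.  At a pole gam / r tends to 1. *)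
Definition area (g : profile) (p : pole) (x y : R) : R :=
  let r := radius x y in
  orient p * (if Req_EM_T r 0 then 1 else gam g (flip g p r) / r).

(** d b = (1 - K) mu. *)
Definition is_primitive {g : profile} (b : one_form g) : Prop :=
  forall (p : pole) (x y : R), in_chart g x y ->
    ext_d b p x y = (1 - curv g (flip g p (radius x y))) * area g p x y.

(** The metric dt^2 + gam(t)^2 dtheta^2 at (x, y) in the chart around p, on the
    tangent vector (u, v); it extends to the poles as the Euclidean metric. *)
Definition metric (g : profile) (p : pole) (x y u v : R) : R :=
  let r := radius x y in
  if Req_EM_T r 0 then u ^ 2 + v ^ 2
  else ((x * u + y * v) / r) ^ 2
       + gam g (flip g p r) ^ 2 * ((x * v - y * u) / r ^ 2) ^ 2.

(** Norm of the covector b_(x,y), dual to the metric. *)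
Definition covector_norm {g : profile} (b : one_form g) (p : pole) (x y : R) : Rbar :=
  Lub_Rbar (fun c => exists u v : R, metric g p x y u v <= 1 /\
                       c = Rabs (form_x b p x y * u + form_y b p x y * v)).

Definition form_norm {g : profile} (b : one_form g) : Rbar :=
  Lub_Rbar (fun c => exists (p : pole) (x y : R), in_chart g x y /\
                       covector_norm b p x y = Finite c).

Definition m_inf (g : profile) : Rbar :=
  Glb_Rbar (fun c => exists b : one_form g, is_primitive b /\
                       form_norm b = Finite c).

(* Main.v *)
(* Write F = Gamma + gamma'.  Near either pole F is even in the distance r to
   the pole and vanishes there, so F = r^2 G with G smooth and even (Hadamard's
   lemma, twice), and F dtheta = G (x dy - y dx) is smooth in the chart; it is
   a primitive because F' = gamma + gamma''.  If beta is any primitive, Stokes'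
   theorem gives its circulation 2 pi F(t) along the circle of radius t.  Hence a
   primitive f(t) dtheta has f = F, and in general |beta_theta| >= |F(t)|
   somewhere on each circle, which bounds ||beta|| below by sup |F| / gamma. *)
Require Import Defs.
From Stdlib Require Import Reals Lra Lia.
From Coquelicot Require Import Coquelicot.

Open Scope R_scope.

(** The work lies at the poles. There the profile has only one-sided derivatives, and the radius is
    not smooth in Cartesian coordinates. The first obstacle is removed by continuing [gam] oddly
    through the pole, which is consistent because its even derivatives vanish there. The second is
    removed by the identity d/dx f(r) = x (f'(r) / r): for even f the quotient f' / r is again
    smooth and even, so that polynomials in x, y and even functions of r are closed under partial
    derivatives. Quotients by r are written as integrals int_0^1 f'(r s) ds instead of divisions, so
    they make sense at the pole, with explicit derivatives. The pole t = ell needs no second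
    argument: reversing the profile exchanges the poles, and since int gamma = 2 makes Gamma run
    from -1 to 1, F only changes sign. *)

(** * Continuity in two variables *)

Lemma locally_Ioo (a b x : R) : a < x < b -> locally x (fun u => a < u < b).
Proof.
  intros H. apply (open_and (fun u => a < u) (fun u => u < b)); [apply open_gt | apply open_lt | exact H].
Qed.

Lemma locally_2d_Ioo (f : R -> R -> R) (a b x y : R) :
  continuity_2d_pt f x y -> a < f x y < b ->
  locally_2d (fun u v => a < f u v < b) x y.
Proof.
  intros Hf H. apply locally_2d_locally.
  apply continuity_2d_pt_filterlim in Hf.
  apply (Hf (fun u => a < u < b)). now apply locally_Ioo.
Qed.

Lemma continuity_2d_pt_comp (f g h : R -> R -> R) (x y : R) :
  continuity_2d_pt g x y -> continuity_2d_pt h x y ->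
  continuity_2d_pt f (g x y) (h x y) ->
  continuity_2d_pt (fun u v => f (g u v) (h u v)) x y.
Proof.
  rewrite !continuity_2d_pt_filterlim. intros Hg Hh Hf.
  apply (continuous_comp_2 (fun z => g (fst z) (snd z)) (fun z => h (fst z) (snd z)) f);
    [exact Hg | exact Hh | exact Hf].
Qed.

Lemma continuity_2d_pt_comp_1d (f : R -> R) (g : R -> R -> R) (x y : R) :
  continuous f (g x y) -> continuity_2d_pt g x y ->
  continuity_2d_pt (fun u v => f (g u v)) x y.
Proof.
  intros Hf Hg. apply continuity_1d_2d_pt_comp; [|exact Hg].
  now apply continuity_pt_filterlim.
Qed.

Lemma continuity_2d_pt_section (f : R -> R -> R) (x y : R) :
  continuity_2d_pt f x y -> continuous (fun v => f x v) y.
Proof.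
  rewrite continuity_2d_pt_filterlim. intros Hf.
  apply (continuous_comp_2 (fun _ => x) (fun v => v) f);
    [apply continuous_const | apply continuous_id | exact Hf].
Qed.

Lemma is_derive_continuous (f : R -> R) (x l : R) : is_derive f x l -> continuous f x.
Proof. intros H. apply (ex_derive_continuous (V := R_NormedModule)). now exists l. Qed.

(** * Towers of derivatives and Hadamard quotients *)

Definition derivatives_on (L : R) (f : nat -> R -> R) : Prop :=
  forall (n : nat) (r : R), - L < r < L -> is_derive (f n) r (f (S n) r).

Lemma derivatives_on_shift (L : R) (f : nat -> R -> R) :
  derivatives_on L f -> derivatives_on L (fun n => f (S n)).
Proof. intros H n. apply H. Qed.

(* The n-th derivative of [(f 0 r - f 0 0) / r], as given by Hadamard's formula
   [f 0 r - f 0 0 = r * int_0^1 f'(r s) ds]. *)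
Definition hadamard (f : nat -> R -> R) (n : nat) (r : R) : R :=
  RInt (fun s => s ^ n * f (S n) (r * s)) 0 1.

Lemma mult_unit_Ioo (L r s : R) : - L < r < L -> 0 <= s <= 1 -> - L < r * s < L.
Proof. intros H Hs. split; nra. Qed.

Lemma continuous_scaled (L : R) (f : nat -> R -> R) (n m : nat) (r s : R) :
  derivatives_on L f -> - L < r < L -> 0 <= s <= 1 ->
  continuous (fun s => s ^ n * f m (r * s)) s.
Proof.
  intros H Hr Hs. apply continuity_pt_filterlim, continuity_pt_mult.
  - apply derivable_continuous_pt, derivable_pt_pow.
  - apply continuity_pt_filterlim.
    apply (continuous_comp (fun s => r * s) (f m)).
    + apply (continuous_scal_r (V := R_NormedModule)). apply continuous_id.
    + eapply is_derive_continuous, H. now apply mult_unit_Ioo.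
Qed.

Lemma ex_RInt_scaled (L : R) (f : nat -> R -> R) (n m : nat) (r : R) :
  derivatives_on L f -> - L < r < L ->
  ex_RInt (fun s => s ^ n * f m (r * s)) 0 1.
Proof.
  intros H Hr. apply (ex_RInt_continuous (V := R_CompleteNormedModule)).
  intros s. rewrite Rmin_left, Rmax_right by lra. intros Hs.
  now apply (continuous_scaled L).
Qed.

(** Differentiation under the integral sign: each derivative in r brings out one more factor s,
    whence the weight s^n. *)
Lemma derivatives_on_hadamard (L : R) (f : nat -> R -> R) :
  derivatives_on L f -> derivatives_on L (hadamard f).
Proof.
  intros H n r Hr. unfold hadamard at 2.
  assert (Hd : forall u s, - L < u * s < L ->
    is_derive (fun u => s ^ n * f (S n) (u * s)) u (s ^ S n * f (S (S n)) (u * s))).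
  { intros u s Hus.
    replace (s ^ S n * f (S (S n)) (u * s)) with (s ^ n * (s * f (S (S n)) (u * s))) by (simpl; ring).
    apply (is_derive_scal (fun u => f (S n) (u * s))).
    apply (is_derive_comp (f (S n)) (fun u => u * s)).
    - now apply H.
    - auto_derive; [trivial | ring]. }
  replace (RInt (fun s => s ^ S n * f (S (S n)) (r * s)) 0 1)
    with (RInt (fun s => Derive (fun u => s ^ n * f (S n) (u * s)) r) 0 1).
  - apply (is_derive_RInt_param (fun u s => s ^ n * f (S n) (u * s))).
    + generalize (locally_Ioo _ _ _ Hr). apply filter_imp. intros u Hu s.
      rewrite Rmin_left, Rmax_right by lra. intros Hs.
      eexists. apply Hd. now apply mult_unit_Ioo.
    + intros s. rewrite Rmin_left, Rmax_right by lra. intros Hs.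
      assert (Hm : continuity_2d_pt (fun u v => u * v) r s).
      { apply continuity_2d_pt_mult; [apply continuity_2d_pt_id1 | apply continuity_2d_pt_id2]. }
      apply continuity_2d_pt_ext_loc with (fun u v => v ^ S n * f (S (S n)) (u * v)).
      * generalize (locally_2d_Ioo _ _ _ _ _ Hm (mult_unit_Ioo _ _ _ Hr Hs)).
        apply locally_2d_impl, locally_2d_forall. intros u v Huv.
        symmetry. apply is_derive_unique. now apply Hd.
      * apply continuity_2d_pt_mult.
        -- apply (continuity_2d_pt_comp_1d (fun v => v ^ S n) (fun _ v => v)).
           ++ apply continuity_pt_filterlim, derivable_continuous_pt, derivable_pt_pow.
           ++ apply continuity_2d_pt_id2.
        -- apply (continuity_2d_pt_comp_1d (f (S (S n))) (fun u v => u * v)); [|exact Hm].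
           eapply is_derive_continuous, H. now apply mult_unit_Ioo.
    + generalize (locally_Ioo _ _ _ Hr). apply filter_imp. intros u Hu.
      now apply (ex_RInt_scaled L).
  - apply RInt_ext. intros s. rewrite Rmin_left, Rmax_right by lra. intros Hs.
    apply is_derive_unique, Hd. apply mult_unit_Ioo; [exact Hr | lra].
Qed.

Lemma hadamard_eq (L : R) (f : nat -> R -> R) (r : R) :
  derivatives_on L f -> - L < r < L -> r * hadamard f 0 r = f 0%nat r - f 0%nat 0.
Proof.
  intros H Hr. unfold hadamard.
  assert (HI : is_RInt (fun s => r * f 1%nat (r * s)) 0 1 (f 0%nat (r * 1) - f 0%nat (r * 0))).
  { apply (is_RInt_derive (fun s => f 0%nat (r * s))).
    - intros s. rewrite Rmin_left, Rmax_right by lra. intros Hs.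
      apply (is_derive_comp (f 0%nat) (fun s => r * s)).
      + apply H. now apply mult_unit_Ioo.
      + auto_derive; [trivial | ring].
    - intros s. rewrite Rmin_left, Rmax_right by lra. intros Hs.
      apply (continuous_scal_r (V := R_NormedModule) r (fun s => f 1%nat (r * s))).
      apply continuous_ext with (fun s => s ^ 0 * f 1%nat (r * s)).
      + intros t. simpl. ring.
      + now apply (continuous_scaled L). }
  apply (is_RInt_unique (V := R_CompleteNormedModule)) in HI. rewrite Rmult_1_r, Rmult_0_r in HI. rewrite <- HI.
  symmetry. etransitivity; [|apply (RInt_scal (V := R_CompleteNormedModule) (fun s => s ^ 0 * f 1%nat (r * s)))].
  - apply RInt_ext. intros s _. unfold scal; simpl; unfold mult; simpl. ring.
  - now apply (ex_RInt_scaled L).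
Qed.

(** At r = 0 the integrand is a constant times s^n. The quotient thus shifts the derivatives at 0 by
    one, up to a factor, which is how vanishing derivatives of one parity pass from a function to
    its quotients. *)
Lemma hadamard_at_0 (f : nat -> R -> R) (n : nat) :
  hadamard f n 0 = f (S n) 0 / INR (S n).
Proof.
  unfold hadamard. apply is_RInt_unique.
  replace (f (S n) 0 / INR (S n))
    with (minus (f (S n) 0 / INR (S n) * 1 ^ S n) (f (S n) 0 / INR (S n) * 0 ^ S n)).
  - apply (is_RInt_derive (fun s => f (S n) 0 / INR (S n) * s ^ S n)).
    + intros s _. auto_derive; [trivial|]. rewrite Rmult_0_l.
      change (Nat.pred (S n)) with n. field. apply (not_0_INR (S n)). lia.
    + intros s _. apply continuous_ext with (fun s => f (S n) 0 * s ^ n).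
      * intros t. rewrite Rmult_0_l. apply Rmult_comm.
      * apply (continuous_scal_r (V := R_NormedModule)).
        apply continuity_pt_filterlim, derivable_continuous_pt, derivable_pt_pow.
  - unfold minus, plus, opp; simpl. rewrite pow1. ring.
Qed.

(** * Even functions of the radius and their smoothness in the plane *)

(** Evenness is asked of the derivatives at 0 only, since such functions are evaluated at radii,
    which are nonnegative. *)
Definition even_derivatives (L : R) (f : nat -> R -> R) : Prop :=
  derivatives_on L f /\ forall k : nat, f (S (2 * k)) 0 = 0.

(** This is f'(r) / r with its derivatives, for f' vanishing at 0. *)
Definition radial_quotient (f : nat -> R -> R) : nat -> R -> R :=
  hadamard (fun n => f (S n)).

Lemma even_derivatives_quotient (L : R) (f : nat -> R -> R) :
  even_derivatives L f -> even_derivatives L (radial_quotient f).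
Proof.
  intros [H H0]. split.
  - now apply derivatives_on_hadamard, derivatives_on_shift.
  - intros k. unfold radial_quotient. rewrite hadamard_at_0.
    replace (S (S (S (2 * k)))) with (S (2 * S k)) by lia. rewrite H0.
    unfold Rdiv. ring.
Qed.

Lemma radial_quotient_eq (L : R) (f : nat -> R -> R) (r : R) :
  even_derivatives L f -> - L < r < L -> r * radial_quotient f 0 r = f 1%nat r.
Proof.
  intros [H H0] Hr. unfold radial_quotient.
  rewrite (hadamard_eq L) by (try apply derivatives_on_shift; assumption).
  specialize (H0 0%nat). simpl in H0. rewrite H0. ring.
Qed.

Lemma radius_nonneg (x y : R) : 0 <= radius x y.
Proof. apply sqrt_pos. Qed.

Lemma radius_sqr (x y : R) : radius x y ^ 2 = x ^ 2 + y ^ 2.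
Proof. unfold radius. rewrite pow2_sqrt; [reflexivity | nra]. Qed.

Lemma radius_sym (x y : R) : radius x y = radius y x.
Proof. unfold radius. f_equal. ring. Qed.

Lemma radius_eq0 (x y : R) : radius x y = 0 -> x = 0 /\ y = 0.
Proof. intros H. generalize (radius_sqr x y). rewrite H. intros. split; nra. Qed.

Lemma radius_0 : radius 0 0 = 0.
Proof. unfold radius. replace (0 ^ 2 + 0 ^ 2) with 0 by ring. apply sqrt_0. Qed.

Lemma radius_polar (r th : R) : 0 <= r -> radius (r * cos th) (r * sin th) = r.
Proof.
  intros Hr. unfold radius.
  replace ((r * cos th) ^ 2 + (r * sin th) ^ 2) with (r ^ 2 * (Rsqr (sin th) + Rsqr (cos th)))
    by (unfold Rsqr; ring).
  rewrite sin2_cos2, Rmult_1_r. now apply sqrt_pow2.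
Qed.

Lemma radius_abs (x : R) : radius x 0 = Rabs x.
Proof. unfold radius. rewrite <- sqrt_Rsqr_abs. f_equal. unfold Rsqr. ring. Qed.

Lemma continuity_2d_radius (x y : R) : continuity_2d_pt radius x y.
Proof.
  apply (continuity_2d_pt_comp_1d sqrt (fun x y => x ^ 2 + y ^ 2)).
  - apply continuous_sqrt.
  - apply continuity_2d_pt_ext with (fun x y => x * x + y * y); [intros; ring|].
    apply continuity_2d_pt_plus; apply continuity_2d_pt_mult;
      apply continuity_2d_pt_id1 || apply continuity_2d_pt_id2.
Qed.

Lemma locally_2d_radius (L x y : R) :
  radius x y < L -> locally_2d (fun u v => radius u v < L) x y.
Proof.
  intros H.
  assert (H' : -1 < radius x y < L) by (generalize (radius_nonneg x y); lra).
  generalize (locally_2d_Ioo _ _ _ _ _ (continuity_2d_radius x y) H').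
  apply locally_2d_impl, locally_2d_forall. tauto.
Qed.

(** Off the origin this is the chain rule with dr/dx = x / r. At the origin r is not differentiable,
    and f'(0) = 0 takes over. *)
Lemma is_derive_radial_x (L : R) (f : nat -> R -> R) (x y : R) :
  even_derivatives L f -> radius x y < L ->
  is_derive (fun z => f 0%nat (radius z y)) x (x * radial_quotient f 0 (radius x y)).
Proof.
  intros Hf Hr. assert (H0 := radius_nonneg x y).
  destruct (Req_dec (radius x y) 0) as [Hz|Hz].
  - assert (HL : - L < 0 < L) by lra.
    destruct (radius_eq0 _ _ Hz) as [-> ->]. rewrite Rmult_0_l.
    assert (Hd := proj1 Hf 0%nat 0 HL).
    rewrite (proj2 Hf 0%nat : f 1%nat 0 = 0) in Hd. apply is_derive_Reals in Hd. apply is_derive_Reals.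
    (* On the axis the radius is |h|. As the derivative is 0, the difference quotients at h and at
       |h| have the same absolute value. *)
    intros eps Heps. destruct (Hd eps Heps) as [d Hd']. exists d. intros h Hh Hhd.
    rewrite Rplus_0_l, !radius_abs, Rabs_R0.
    assert (Habs : Rabs (Rabs h) < d) by now rewrite Rabs_Rabsolu.
    specialize (Hd' (Rabs h) (Rabs_no_R0 _ Hh) Habs). rewrite Rplus_0_l in Hd'.
    rewrite Rminus_0_r in *. unfold Rdiv in *. rewrite Rabs_mult in *.
    rewrite !Rabs_inv, ?Rabs_Rabsolu in *. exact Hd'.
  - assert (Hp : 0 < radius x y) by lra.
    assert (HL : - L < radius x y < L) by lra.
    replace (x * radial_quotient f 0 (radius x y))
      with (x / radius x y * (radius x y * radial_quotient f 0 (radius x y))) by (field; exact Hz).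
    rewrite (radial_quotient_eq L) by assumption.
    apply (is_derive_comp (f 0%nat) (fun z => radius z y)).
    + now apply (proj1 Hf).
    + unfold radius in *. auto_derive.
      * apply sqrt_lt_0_alt. rewrite sqrt_0. exact Hp.
      * simpl. field. exact Hz.
Qed.

Lemma is_derive_radial_y (L : R) (f : nat -> R -> R) (x y : R) :
  even_derivatives L f -> radius x y < L ->
  is_derive (fun z => f 0%nat (radius x z)) y (y * radial_quotient f 0 (radius x y)).
Proof.
  intros Hf Hr. rewrite radius_sym in *.
  apply is_derive_ext with (fun z => f 0%nat (radius z x)).
  - intros z. now rewrite radius_sym.
  - now apply (is_derive_radial_x L).
Qed.

(* A class of functions on the disc of radius [L] which is closed under partial
   derivatives; their smoothness then follows from their continuity. *)
Inductive radial_poly (L : R) : (R -> R -> R) -> Prop :=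
| radial_poly_even (f : nat -> R -> R) :
    even_derivatives L f -> radial_poly L (fun x y => f 0%nat (radius x y))
| radial_poly_const (c : R) : radial_poly L (fun _ _ => c)
| radial_poly_x : radial_poly L (fun x _ => x)
| radial_poly_y : radial_poly L (fun _ y => y)
| radial_poly_plus (f g : R -> R -> R) : radial_poly L f -> radial_poly L g ->
    radial_poly L (fun x y => f x y + g x y)
| radial_poly_mult (f g : R -> R -> R) : radial_poly L f -> radial_poly L g ->
    radial_poly L (fun x y => f x y * g x y).

Lemma radial_poly_continuous (L : R) (f : R -> R -> R) (x y : R) :
  radial_poly L f -> radius x y < L -> continuity_2d_pt f x y.
Proof.
  intros Hf Hr. induction Hf.
  - apply (continuity_2d_pt_comp_1d (f 0%nat) radius); [|apply continuity_2d_radius].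
    eapply is_derive_continuous, (proj1 H). generalize (radius_nonneg x y). lra.
  - apply continuity_2d_pt_const.
  - apply continuity_2d_pt_id1.
  - apply continuity_2d_pt_id2.
  - now apply continuity_2d_pt_plus.
  - now apply continuity_2d_pt_mult.
Qed.

(** The decisive case is f(r): its partial derivatives are x and y times f' / r, and f' / r is again
    even. The other cases are the rules for sums and products. *)
Lemma radial_poly_partial (L : R) (f : R -> R -> R) :
  radial_poly L f -> exists fx fy : R -> R -> R,
    radial_poly L fx /\ radial_poly L fy /\
    forall x y, radius x y < L ->
      is_derive (fun z => f z y) x (fx x y) /\ is_derive (fun z => f x z) y (fy x y).
Proof.
  intros Hf. induction Hf as [f H|c| | |f g Hf IHf Hg IHg|f g Hf IHf Hg IHg].
  - exists (fun x y => x * radial_quotient f 0 (radius x y)),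
      (fun x y => y * radial_quotient f 0 (radius x y)).
    assert (Hq := radial_poly_even L _ (even_derivatives_quotient _ _ H)).
    split; [|split; [|intros x y Hr; split]].
    + apply radial_poly_mult; [constructor | exact Hq].
    + apply (radial_poly_mult L (fun _ y => y)); [constructor | exact Hq].
    + now apply (is_derive_radial_x L).
    + now apply (is_derive_radial_y L).
  - exists (fun _ _ => 0), (fun _ _ => 0).
    split; [constructor | split; [constructor|]]. intros x y Hr; split; apply (is_derive_const (V := R_NormedModule)).
  - exists (fun _ _ => 1), (fun _ _ => 0).
    split; [constructor | split; [constructor|]]. intros x y Hr; split.
    + apply (is_derive_id (K := R_AbsRing)).
    + apply (is_derive_const (V := R_NormedModule)).
  - exists (fun _ _ => 0), (fun _ _ => 1).
    split; [constructor | split; [constructor|]]. intros x y Hr; split.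
    + apply (is_derive_const (V := R_NormedModule)).
    + apply (is_derive_id (K := R_AbsRing)).
  - destruct IHf as (fx & fy & Hfx & Hfy & Hdf). destruct IHg as (gx & gy & Hgx & Hgy & Hdg).
    exists (fun x y => fx x y + gx x y), (fun x y => fy x y + gy x y).
    split; [now constructor | split; [now constructor|]]. intros x y Hr; split.
    + apply (is_derive_plus (V := R_NormedModule)); [now apply Hdf | now apply Hdg].
    + apply (is_derive_plus (V := R_NormedModule)); [now apply Hdf | now apply Hdg].
  - destruct IHf as (fx & fy & Hfx & Hfy & Hdf). destruct IHg as (gx & gy & Hgx & Hgy & Hdg).
    exists (fun x y => fx x y * g x y + f x y * gx x y),
      (fun x y => fy x y * g x y + f x y * gy x y).
    split; [repeat constructor; assumption|].
    split; [repeat constructor; assumption|].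
    intros x y Hxy. destruct (Hdf x y Hxy), (Hdg x y Hxy).
    split.
    + apply (is_derive_mult (fun z => f z y) (fun z => g z y)); auto using Rmult_comm.
    + apply (is_derive_mult (fun z => f x z) (fun z => g x z)); auto using Rmult_comm.
Qed.

Lemma radial_poly_smooth (L : R) (f : R -> R -> R) (n : nat) (x y : R) :
  radial_poly L f -> radius x y < L -> ex_diff_n f n x y.
Proof.
  revert f. induction n as [|n IH]; intros f Hf Hr; simpl.
  - split; [now apply (radial_poly_continuous L) | trivial].
  - destruct (radial_poly_partial L f Hf) as (fx & fy & Hfx & Hfy & Hd).
    split; [now apply (radial_poly_continuous L)|].
    split; [now exists (fx x y); apply Hd|].
    split; [now exists (fy x y); apply Hd|].
    split; [apply ex_diff_n_ext_loc with fx | apply ex_diff_n_ext_loc with fy]; try now apply IH.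
    all: generalize (locally_2d_radius _ _ _ Hr); apply locally_2d_impl, locally_2d_forall.
    all: intros u v Huv; symmetry; apply is_derive_unique; now apply Hd.
Qed.

(** * One-sided derivatives, reversal and odd continuation of the profile *)

(** Without division and with y = x allowed, one-sided estimates can be reflected and glued into
    two-sided ones. *)
Lemma D_in_iff (f d : R -> R) (D : R -> Prop) (x : R) :
  D_in f d D x <->
  forall eps : R, 0 < eps -> exists del : R, 0 < del /\
    forall y, D y -> Rabs (y - x) < del ->
      Rabs (f y - f x - d x * (y - x)) <= eps * Rabs (y - x).
Proof.
  assert (Hq : forall y, y - x <> 0 ->
    Rabs (f y - f x - d x * (y - x)) = Rabs ((f y - f x) / (y - x) - d x) * Rabs (y - x)).
  { intros y Hy. rewrite <- Rabs_mult. f_equal. field. exact Hy. }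
  split; intros H eps Heps.
  - destruct (H eps Heps) as (del & Hdel & Hd). exists del. split; [exact Hdel|].
    intros y Dy Hy. destruct (Req_dec y x) as [->|Hne].
    + rewrite !Rminus_diag, Rmult_0_r, Rminus_0_r, Rabs_R0. lra.
    + rewrite Hq by lra. apply Rmult_le_compat_r; [apply Rabs_pos|].
      apply Rlt_le, (Hd y). split; [split; [exact Dy | now apply not_eq_sym] | exact Hy].
  (* [D_in] asks for a strict inequality, hence eps / 2. *)
  - destruct (H (eps / 2)) as (del & Hdel & Hd); [lra|]. exists del. split; [exact Hdel|].
    intros y [[Dy Hne] Hy]. simpl in *. unfold Rdist in *.
    assert (Hp : 0 < Rabs (y - x)) by (apply Rabs_pos_lt; lra).
    specialize (Hd y Dy Hy). rewrite Hq in Hd by lra.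
    apply Rmult_le_reg_r in Hd; lra.
Qed.

Lemma is_derive_iff (f : R -> R) (x l : R) :
  is_derive f x l <->
  forall eps : R, 0 < eps -> exists del : R, 0 < del /\
    forall y, Rabs (y - x) < del -> Rabs (f y - f x - l * (y - x)) <= eps * Rabs (y - x).
Proof.
  rewrite is_derive_Reals, <- (derivable_pt_lim_D_in f (fun _ => l)), D_in_iff.
  unfold no_cond. firstorder.
Qed.

Lemma dgam_cont (g : profile) (n : nat) (t : R) : 0 <= t <= ell g ->
  forall eps : R, 0 < eps -> exists del : R, 0 < del /\
    forall y, 0 <= y <= ell g -> Rabs (y - t) < del -> Rabs (dgam g n y - dgam g n t) < eps.
Proof.
  intros Ht eps Heps.
  destruct (cont_deriv _ _ _ _ (dgam_deriv g n t Ht) eps Heps) as (del & Hdel & Hd).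
  exists del. split; [exact Hdel|]. intros y Hy Hyt.
  destruct (Req_dec y t) as [->|Hne].
  - rewrite Rminus_diag, Rabs_R0. exact Heps.
  - apply (Hd y). split; [split; [exact Hy | now apply not_eq_sym] | exact Hyt].
Qed.

Lemma ex_RInt_gam (g : profile) (a b : R) :
  0 <= a <= ell g -> 0 <= b <= ell g -> ex_RInt (gam g) a b.
Proof.
  intros Ha Hb. assert (Hl := ell_pos g).
  (* [gam] is known to be continuous only relative to [0, ell]. Composing it with this clamp gives a
     function continuous on the whole line that agrees with it on the interval. *)
  pose (c := fun t => Rmax 0 (Rmin t (ell g))).
  assert (Hc : forall t, 0 <= c t <= ell g).
  { intros t. unfold c, Rmax, Rmin. repeat destruct Rle_dec; lra. }
  assert (Hlip : forall s t, Rabs (c s - c t) <= Rabs (s - t)).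
  { intros s t. unfold c, Rmax, Rmin. repeat destruct Rle_dec;
      unfold Rabs; repeat destruct Rcase_abs; lra. }
  apply (ex_RInt_ext (V := R_NormedModule)) with (fun t => gam g (c t)).
  - intros t Ht. f_equal. unfold c, Rmin, Rmax in *. repeat destruct Rle_dec; lra.
  - apply (ex_RInt_continuous (V := R_CompleteNormedModule)). intros t _.
    apply continuity_pt_filterlim. intros eps Heps.
    destruct (dgam_cont g 0 (c t) (Hc t) eps Heps) as (del & Hdel & Hd).
    exists del. split; [exact Hdel|]. intros y [_ Hy]. apply Hd; [apply Hc|].
    eapply Rle_lt_trans; [apply Hlip | exact Hy].
Qed.

Lemma RInt_gam_reflect (g : profile) (a b : R) :
  0 <= a <= ell g -> 0 <= b <= ell g ->
  RInt (fun t => gam g (ell g - t)) a b = RInt (gam g) (ell g - b) (ell g - a).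
Proof.
  intros Ha Hb.
  assert (H := RInt_comp_lin (V := R_CompleteNormedModule) (gam g) (-1) (ell g) a b).
  replace (-1 * a + ell g) with (ell g - a) in H by ring.
  replace (-1 * b + ell g) with (ell g - b) in H by ring.
  rewrite <- (opp_RInt_swap (gam g)) by (apply ex_RInt_gam; lra).
  rewrite <- H by (apply ex_RInt_gam; lra).
  rewrite (RInt_scal (V := R_CompleteNormedModule) (fun t => gam g (-1 * t + ell g))).
  - assert (E : forall z : R, z = - (-1 * z)) by (intros; ring).
    rewrite (RInt_ext (V := R_CompleteNormedModule) _ (fun t => gam g (-1 * t + ell g)))
      by (intros; f_equal; ring).
    apply E.
  - apply (ex_RInt_ext (V := R_NormedModule)) with (fun t => scal (-1) (scal (-1) (gam g (-1 * t + ell g)))).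
    { intros t _. unfold scal; simpl; unfold mult; simpl. ring. }
    apply (ex_RInt_scal (V := R_NormedModule)).
    apply (ex_RInt_comp_lin (V := R_NormedModule) (gam g)).
    apply ex_RInt_gam; lra.
Qed.

Lemma rev_deriv (g : profile) (n : nat) (t : R) : 0 <= t <= ell g ->
  D_in (fun s => (-1) ^ n * dgam g n (ell g - s))
       (fun s => (-1) ^ S n * dgam g (S n) (ell g - s)) (fun s => 0 <= s <= ell g) t.
Proof.
  intros Ht. apply D_in_iff. intros eps Heps.
  assert (Hu : 0 <= ell g - t <= ell g) by lra.
  destruct (proj1 (D_in_iff _ _ _ _) (dgam_deriv g n _ Hu) eps Heps) as (del & Hdel & Hd).
  exists del. split; [exact Hdel|]. intros y Hy Hyt.
  assert (Hab : Rabs (ell g - y - (ell g - t)) = Rabs (y - t)).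
  { rewrite <- Rabs_Ropp. f_equal. ring. }
  specialize (Hd (ell g - y)). rewrite Hab in Hd.
  replace ((-1) ^ n * dgam g n (ell g - y) - (-1) ^ n * dgam g n (ell g - t) -
           (-1) ^ S n * dgam g (S n) (ell g - t) * (y - t))
    with ((-1) ^ n * (dgam g n (ell g - y) - dgam g n (ell g - t) -
           dgam g (S n) (ell g - t) * (ell g - y - (ell g - t)))) by (simpl; ring).
  rewrite Rabs_mult, pow_1_abs, Rmult_1_l. apply Hd; [lra | exact Hyt].
Qed.

(** The profile seen from the other pole; it turns every computation near t = ell into one near t =
    0. *)
Program Definition rev (g : profile) : profile :=
  {| ell := ell g; dgam := fun n t => (-1) ^ n * dgam g n (ell g - t) |}.
Next Obligation. apply ell_pos. Qed.
Next Obligation. apply rev_deriv. lra. Qed.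
Next Obligation. rewrite Rminus_0_r, gam_ell. ring. Qed.
Next Obligation. rewrite Rminus_diag, gam_0. ring. Qed.
Next Obligation. rewrite Rmult_1_l. apply gam_pos. lra. Qed.
Next Obligation. rewrite Rminus_0_r, dgam_ell. ring. Qed.
Next Obligation. rewrite Rminus_diag, dgam_0. ring. Qed.
Next Obligation. rewrite Rmult_1_r, Rabs_mult, Rabs_m1, Rmult_1_l. apply dgam_lt1. lra. Qed.
Next Obligation. rewrite Rminus_0_r. apply Rmult_eq_0_compat. right. apply (dgam_even_ell g k). Qed.
Next Obligation. rewrite Rminus_diag. apply Rmult_eq_0_compat. right. apply (dgam_even_0 g k). Qed.
Next Obligation.
  assert (Hl := ell_pos g). rewrite <- (gam_int g).
  transitivity (RInt (fun t => gam g (ell g - t)) 0 (ell g)).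
  - apply RInt_ext. intros t _. apply Rmult_1_l.
  - rewrite RInt_gam_reflect by lra. rewrite Rminus_diag, Rminus_0_r. reflexivity.
Qed.

Lemma gam_rev (g : profile) (t : R) : gam (rev g) t = gam g (ell g - t).
Proof. apply Rmult_1_l. Qed.

(** The normalisation int gamma = 2 enters here: [Gam] runs from -1 to 1, so exchanging the poles
    changes its sign. The derivative of [gam] also changes sign, hence so does F. *)
Lemma Gam_rev (g : profile) (t : R) : 0 <= t <= ell g ->
  Gam (rev g) t = - Gam g (ell g - t).
Proof.
  intros Ht. unfold Gam.
  rewrite (RInt_ext (V := R_CompleteNormedModule) (gam (rev g)) (fun t => gam g (ell g - t)))
    by (intros; apply gam_rev).
  rewrite RInt_gam_reflect by lra. rewrite Rminus_0_r.
  assert (H := RInt_Chasles (V := R_CompleteNormedModule) (gam g) 0 (ell g - t) (ell g)).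
  assert (H2 := gam_int g). change (dgam g 0) with (gam g) in H2. rewrite H2 in H.
  assert (H' := H ltac:(apply ex_RInt_gam; lra) ltac:(apply ex_RInt_gam; lra)).
  unfold plus in H'; simpl in H'. lra.
Qed.

(* Continuation of [gam] by oddness, so that derivatives at the pole become
   two-sided. *)
Definition odd_ext (g : profile) (n : nat) (r : R) : R :=
  if Rle_dec 0 r then dgam g n r else (-1) ^ S n * dgam g n (- r).

Lemma odd_ext_nonneg (g : profile) (n : nat) (r : R) : 0 <= r -> odd_ext g n r = dgam g n r.
Proof. intros H. unfold odd_ext. destruct Rle_dec; [reflexivity | lra]. Qed.

Lemma odd_ext_even_0 (g : profile) (k : nat) : odd_ext g (2 * k) 0 = 0.
Proof. rewrite odd_ext_nonneg by lra. apply dgam_even_0. Qed.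

(** The two branches agree at r = 0: for odd n the sign is 1, and for even n both values vanish. *)
Lemma odd_ext_nonpos (g : profile) (n : nat) (r : R) : r <= 0 ->
  odd_ext g n r = (-1) ^ S n * dgam g n (- r).
Proof.
  intros H. unfold odd_ext. destruct Rle_dec as [H'|]; [|reflexivity].
  replace r with 0 by lra. rewrite Ropp_0.
  destruct (Nat.Even_or_Odd n) as [[k ->]|[k ->]].
  - rewrite dgam_even_0. ring.
  - replace (S (2 * k + 1)) with (2 * S k)%nat by lia. rewrite pow_1_even. ring.
Qed.

(** On either side of 0 the estimate comes from the one-sided derivative of [dgam]. Both branches
    are valid at 0, so the two estimates combine there. *)
Lemma odd_ext_derivatives (g : profile) : derivatives_on (ell g) (odd_ext g).
Proof.
  intros n r Hr. apply is_derive_iff. intros eps Heps.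
  assert (Hpos : 0 <= r -> exists del, 0 < del /\ forall y, 0 <= y -> Rabs (y - r) < del ->
    Rabs (odd_ext g n y - odd_ext g n r - odd_ext g (S n) r * (y - r)) <= eps * Rabs (y - r)).
  { intros H0. assert (Hr' : 0 <= r <= ell g) by lra.
    destruct (proj1 (D_in_iff _ _ _ _) (dgam_deriv g n r Hr') eps Heps) as (del & Hdel & Hd).
    (* The second bound keeps y below ell, where [dgam] carries information. *)
    exists (Rmin del (ell g - r)). split; [apply Rmin_pos; lra|]. intros y Hy Hyr.
    assert (H1 := Rmin_l del (ell g - r)). assert (H2 := Rmin_r del (ell g - r)).
    rewrite !odd_ext_nonneg by assumption. apply Hd; [|lra].
    assert (H3 := Rle_abs (y - r)). lra. }
  assert (Hneg : r <= 0 -> exists del, 0 < del /\ forall y, y <= 0 -> Rabs (y - r) < del ->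
    Rabs (odd_ext g n y - odd_ext g n r - odd_ext g (S n) r * (y - r)) <= eps * Rabs (y - r)).
  { intros H0. assert (Hr' : 0 <= - r <= ell g) by lra.
    destruct (proj1 (D_in_iff _ _ _ _) (dgam_deriv g n _ Hr') eps Heps) as (del & Hdel & Hd).
    exists (Rmin del (ell g + r)). split; [apply Rmin_pos; lra|]. intros y Hy Hyr.
    assert (H1 := Rmin_l del (ell g + r)). assert (H2 := Rmin_r del (ell g + r)).
    assert (Hab : Rabs (- y - - r) = Rabs (y - r)).
    { rewrite <- Rabs_Ropp. f_equal. ring. }
    rewrite !odd_ext_nonpos by assumption.
    replace ((-1) ^ S n * dgam g n (- y) - (-1) ^ S n * dgam g n (- r) -
             (-1) ^ S (S n) * dgam g (S n) (- r) * (y - r))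
      with ((-1) ^ S n * (dgam g n (- y) - dgam g n (- r) - dgam g (S n) (- r) * (- y - - r)))
      by (simpl; ring).
    rewrite Rabs_mult, pow_1_abs, Rmult_1_l, <- Hab. rewrite <- Hab in Hyr.
    apply Hd; [|lra]. assert (H3 := Rle_abs (- y - - r)). lra. }
  destruct (Rtotal_order r 0) as [Hlt|[->|Hgt]].
  - destruct Hneg as (del & Hdel & Hd); [lra|].
    exists (Rmin del (- r)). split; [apply Rmin_pos; lra|]. intros y Hy.
    assert (H1 := Rmin_l del (- r)). assert (H2 := Rmin_r del (- r)).
    assert (H3 := Rle_abs (y - r)). apply Hd; lra.
  - destruct Hneg as (d1 & Hd1 & H1); [lra|]. destruct Hpos as (d2 & Hd2 & H2); [lra|].
    exists (Rmin d1 d2). split; [now apply Rmin_pos|]. intros y Hy.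
    assert (H3 := Rmin_l d1 d2). assert (H4 := Rmin_r d1 d2).
    destruct (Rle_dec 0 y); [apply H2 | apply H1]; lra.
  - destruct Hpos as (del & Hdel & Hd); [lra|].
    exists (Rmin del r). split; [apply Rmin_pos; lra|]. intros y Hy.
    assert (H1 := Rmin_l del r). assert (H2 := Rmin_r del r).
    assert (H3 := Rle_abs (- (y - r))). rewrite Rabs_Ropp in H3. apply Hd; lra.
Qed.

(* [Gam + gam'] and its derivatives, continued to [(- ell, ell)]. *)
Definition theta_coef (g : profile) (n : nat) (r : R) : R :=
  match n with
  | O => -1 + RInt (odd_ext g 0) 0 r + odd_ext g 1 r
  | S m => odd_ext g m r + odd_ext g (S (S m)) r
  end.

Lemma theta_coef_derivatives (g : profile) : derivatives_on (ell g) (theta_coef g).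
Proof.
  assert (H := odd_ext_derivatives g). intros [|m] r Hr; cbn [theta_coef].
  - apply (is_derive_plus (V := R_NormedModule) (fun r => -1 + RInt (odd_ext g 0) 0 r)); [|now apply H].
    rewrite <- (Rplus_0_l (odd_ext g 0 r)).
    apply (is_derive_plus (V := R_NormedModule) (fun _ => -1)).
    { apply (is_derive_const (V := R_NormedModule)). }
    apply (is_derive_RInt (V := R_NormedModule) (odd_ext g 0) _ 0).
    + generalize (locally_Ioo _ _ _ Hr). apply filter_imp. intros u Hu.
      apply (RInt_correct (V := R_CompleteNormedModule)),
        (ex_RInt_continuous (V := R_CompleteNormedModule)).
      intros z Hz. eapply is_derive_continuous, H.
      revert Hz. unfold Rmin, Rmax. destruct Rle_dec; lra.
    + eapply is_derive_continuous. now apply H.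
  - apply (is_derive_plus (V := R_NormedModule)); now apply H.
Qed.

(** The value Gamma(0) = -1 cancels gamma'(0) = 1. *)
Lemma theta_coef_0 (g : profile) : theta_coef g 0 0 = 0.
Proof.
  cbn [theta_coef]. rewrite RInt_point, odd_ext_nonneg, dgam_0 by lra.
  unfold zero; simpl. lra.
Qed.

(** Odd derivatives of F are sums of two even derivatives of gamma. *)
Lemma theta_coef_odd_0 (g : profile) (k : nat) : theta_coef g (S (2 * k)) 0 = 0.
Proof.
  cbn [theta_coef]. replace (S (S (2 * k))) with (2 * S k)%nat by lia.
  rewrite !odd_ext_even_0. ring.
Qed.

Lemma theta_coef_eq (g : profile) (t : R) : 0 <= t -> theta_coef g 0 t = Gam g t + dgam g 1 t.
Proof.
  intros Ht. cbn [theta_coef]. rewrite odd_ext_nonneg by assumption. unfold Gam.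
  do 2 f_equal. apply RInt_ext. intros s. rewrite Rmin_left by assumption. intros Hs.
  apply odd_ext_nonneg. lra.
Qed.

(** * Quotients of F, gamma and gamma'' at a pole *)

Definition theta_quotient (g : profile) : nat -> R -> R := hadamard (hadamard (theta_coef g)).

(** Two Hadamard quotients shift the derivatives at 0 by two, so their parity is kept. *)
Lemma theta_quotient_even (g : profile) : even_derivatives (ell g) (theta_quotient g).
Proof.
  split.
  - apply derivatives_on_hadamard, derivatives_on_hadamard, theta_coef_derivatives.
  - intros k. unfold theta_quotient. rewrite !hadamard_at_0.
    replace (S (S (S (2 * k)))) with (S (2 * S k)) by lia.
    rewrite theta_coef_odd_0. unfold Rdiv. ring.
Qed.

Lemma theta_quotient_eq (g : profile) (r : R) : - ell g < r < ell g ->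
  theta_coef g 0 r = r ^ 2 * theta_quotient g 0 r.
Proof.
  intros Hr. assert (H := theta_coef_derivatives g).
  assert (H1 := hadamard_eq _ _ _ H Hr).
  assert (H2 := hadamard_eq _ _ _ (derivatives_on_hadamard _ _ H) Hr).
  rewrite theta_coef_0 in H1. rewrite hadamard_at_0 in H2.
  rewrite (theta_coef_odd_0 g 0 : theta_coef g 1 0 = 0) in H2. unfold theta_quotient.
  replace (r ^ 2 * hadamard (hadamard (theta_coef g)) 0 r)
    with (r * (r * hadamard (hadamard (theta_coef g)) 0 r)) by ring.
  rewrite H2. unfold Rdiv. rewrite Rmult_0_l, Rminus_0_r, H1. ring.
Qed.

(** This function and the next are gamma / r and gamma'' / r, continued through the pole. The
    curvature is minus the quotient of the second by the first, with a denominator that is nonzero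
    at the pole. *)
Definition gam_quotient (g : profile) : R -> R := hadamard (odd_ext g) 0.
Definition gam2_quotient (g : profile) : R -> R := hadamard (fun n => odd_ext g (S (S n))) 0.

Lemma gam_quotient_eq (g : profile) (r : R) : 0 <= r < ell g -> gam g r = r * gam_quotient g r.
Proof.
  intros Hr. unfold gam_quotient.
  rewrite (hadamard_eq (ell g)) by (apply odd_ext_derivatives || lra).
  rewrite (odd_ext_even_0 g 0 : odd_ext g 0 0 = 0), odd_ext_nonneg by lra. unfold gam. ring.
Qed.

Lemma gam2_quotient_eq (g : profile) (r : R) : 0 <= r < ell g ->
  dgam g 2 r = r * gam2_quotient g r.
Proof.
  intros Hr. unfold gam2_quotient.
  rewrite (hadamard_eq (ell g)) by
    (exact (derivatives_on_shift _ _ (derivatives_on_shift _ _ (odd_ext_derivatives g))) || lra).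
  rewrite (odd_ext_even_0 g 1 : odd_ext g 2 0 = 0), odd_ext_nonneg by lra. ring.
Qed.

Lemma gam_quotient_0 (g : profile) : gam_quotient g 0 = 1.
Proof.
  unfold gam_quotient. rewrite hadamard_at_0, odd_ext_nonneg, dgam_0 by lra. simpl. field.
Qed.

Lemma gam_quotient_pos (g : profile) (r : R) : 0 <= r < ell g -> 0 < gam_quotient g r.
Proof.
  intros Hr. destruct (Req_dec r 0) as [->|Hne].
  - rewrite gam_quotient_0. lra.
  - assert (H : 0 < gam g r) by (apply gam_pos; lra).
    rewrite gam_quotient_eq in H by assumption. nra.
Qed.

Lemma hadamard_continuous_0 (g : profile) (f : nat -> R -> R) :
  derivatives_on (ell g) f -> continuous (hadamard f 0) 0.
Proof.
  intros Hf. assert (H0 : - ell g < 0 < ell g) by (generalize (ell_pos g); lra).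
  exact (is_derive_continuous _ _ _ (derivatives_on_hadamard _ _ Hf 0%nat 0 H0)).
Qed.

Lemma gam_quotient_continuous_0 (g : profile) : continuous (gam_quotient g) 0.
Proof. exact (hadamard_continuous_0 g (odd_ext g) (odd_ext_derivatives g)). Qed.

Lemma gam2_quotient_continuous_0 (g : profile) : continuous (gam2_quotient g) 0.
Proof.
  apply (hadamard_continuous_0 g (fun n => odd_ext g (S (S n))));
    exact (derivatives_on_shift _ _ (derivatives_on_shift _ _ (odd_ext_derivatives g))).
Qed.

Lemma theta_quotient_continuous_0 (g : profile) : continuous (theta_quotient g 0) 0.
Proof.
  apply (hadamard_continuous_0 g (hadamard (theta_coef g))).
  apply derivatives_on_hadamard, theta_coef_derivatives.
Qed.

(* The identity [F'(r) = gam + gam''], [F = r^2 G], divided by [r]. *)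
Lemma theta_quotient_derivative (g : profile) (r : R) : 0 <= r < ell g ->
  2 * theta_quotient g 0 r + r * theta_quotient g 1 r = gam_quotient g r + gam2_quotient g r.
Proof.
  intros Hr. assert (Hr' : - ell g < r < ell g) by lra.
  destruct (Req_dec r 0) as [->|Hne].
  (* At the pole the identity cannot be divided by r; there both sides are gamma'(0) +
     gamma'''(0). *)
  - unfold theta_quotient, gam_quotient, gam2_quotient. rewrite !hadamard_at_0.
    cbn [theta_coef]. simpl. field.
  - apply Rmult_eq_reg_l with r; [|exact Hne].
    rewrite (Rmult_plus_distr_l r (gam_quotient g r)), <- gam_quotient_eq, <- gam2_quotient_eq by assumption.
    transitivity (theta_coef g 1 r).
    + rewrite <- (is_derive_unique _ _ _ (theta_coef_derivatives g 0%nat r Hr')).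
      symmetry. apply is_derive_unique.
      apply is_derive_ext_loc with (fun r => r ^ 2 * theta_quotient g 0 r).
      * generalize (locally_Ioo _ _ _ Hr'). apply filter_imp. intros u Hu.
        symmetry. now apply theta_quotient_eq.
      * replace (r * (2 * theta_quotient g 0 r + r * theta_quotient g 1 r))
          with (2 * r * theta_quotient g 0 r + r ^ 2 * theta_quotient g 1 r) by ring.
        apply (is_derive_mult (fun r => r ^ 2) (theta_quotient g 0)).
        -- auto_derive; [trivial | ring].
        -- now apply (proj1 (theta_quotient_even g)).
        -- apply Rmult_comm.
    + cbn [theta_coef]. rewrite !odd_ext_nonneg by lra. reflexivity.
Qed.

(** * Passage between t and the distance to a pole *)

Definition local_profile (g : profile) (p : pole) : profile :=
  match p with North => g | South => rev g end.

Lemma ell_local (g : profile) (p : pole) : ell (local_profile g p) = ell g.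
Proof. destruct p; reflexivity. Qed.

Lemma gam_local (g : profile) (p : pole) (r : R) : gam g (flip g p r) = gam (local_profile g p) r.
Proof. destruct p; [reflexivity | symmetry; apply gam_rev]. Qed.

Lemma dgam2_local (g : profile) (p : pole) (r : R) :
  dgam g 2 (flip g p r) = dgam (local_profile g p) 2 r.
Proof. destruct p; simpl; ring. Qed.

Lemma theta_coef_local (g : profile) (p : pole) (r : R) : 0 <= r <= ell g ->
  Gam g (flip g p r) + dgam g 1 (flip g p r) = orient p * theta_coef (local_profile g p) 0 r.
Proof.
  intros Hr. rewrite theta_coef_eq by lra. destruct p; simpl.
  - ring.
  - rewrite Gam_rev by assumption. ring.
Qed.

Lemma flip_flip (g : profile) (p : pole) (t : R) : flip g p (flip g p t) = t.
Proof. destruct p; simpl; ring. Qed.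

Lemma flip_bounds (g : profile) (p : pole) (t : R) : 0 < t < ell g -> 0 < flip g p t < ell g.
Proof. destruct p; simpl; lra. Qed.

(** In terms of the distance to p, f is h away from the pole, so continuity of h supplies the
    one-sided limit that [iota] selects at the pole. *)
Lemma cont_ext_flip (g : profile) (p : pole) (f h : R -> R) (r : R) :
  (forall s, 0 < s < ell g -> f (flip g p s) = h s) -> continuous h 0 ->
  0 <= r < ell g -> cont_ext g f (flip g p r) = h r.
Proof.
  intros Hfh Hh Hr.
  assert (Hat : at_right 0 (fun s => 0 < s < ell g)).
  { assert (Hl : -1 < 0 < ell g) by lra.
    generalize (locally_Ioo _ _ _ Hl). unfold at_right, within.
    apply filter_imp. intros u Hu H. lra. }
  assert (Hlim : filterlim h (at_right 0) (locally (h 0))).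
  { apply filterlim_filter_le_1 with (2 := Hh). intros P HP.
    unfold at_right, within. revert HP. apply filter_imp. tauto. }
  destruct (Req_dec r 0) as [->|Hne].
  - unfold cont_ext. destruct p; simpl.
    + destruct Rle_dec as [_|]; [|lra].
      apply (iota_filterlim_locally (V := R_CompleteNormedModule)).
      eapply filterlim_ext_loc; [|exact Hlim].
      revert Hat. apply filter_imp. intros u Hu. symmetry. now apply Hfh.
    + destruct Rle_dec as [|_]; [lra|]. destruct Rle_dec as [_|]; [|lra].
      apply (iota_filterlim_locally (V := R_CompleteNormedModule)).
      (* At the south pole the limit is one from the left in t; reflection turns it into a limit
         from the right in the distance. *)
      assert (Hrefl : filterlim (fun t => ell g - t) (at_left (ell g)) (at_right 0)).
      { intros P [d Hd]. exists d. intros y Hy Hlt. apply Hd; [|lra].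
        unfold ball in *; simpl in *. unfold AbsRing_ball, abs, minus, plus, opp in *; simpl in *.
        replace (ell g - y + - 0) with (- (y + - ell g)) by ring. now rewrite Rabs_Ropp. }
      eapply filterlim_ext_loc; [|exact (filterlim_comp _ _ _ _ _ _ _ _ Hrefl Hlim)].
      generalize (Hrefl _ Hat). unfold filtermap. apply filter_imp. intros u Hu.
      rewrite <- Hfh by assumption. simpl. f_equal. ring.
  - rewrite <- Hfh by lra. unfold cont_ext.
    assert (Hf := flip_bounds g p r). do 2 (destruct Rle_dec as [|_]; [lra|]). reflexivity.
Qed.

Lemma curv_flip (g : profile) (p : pole) (r : R) : 0 <= r < ell g ->
  curv g (flip g p r) =
    - gam2_quotient (local_profile g p) r / gam_quotient (local_profile g p) r.
Proof.
  intros Hr. apply (cont_ext_flip g p _ (fun r =>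
    - gam2_quotient (local_profile g p) r / gam_quotient (local_profile g p) r));
    [| |exact Hr].
  - intros s Hs. assert (Hs' : 0 <= s < ell (local_profile g p)) by (rewrite ell_local; lra).
    rewrite gam_local, dgam2_local, gam_quotient_eq, gam2_quotient_eq by assumption.
    field. assert (H := gam_quotient_pos _ _ Hs'). lra.
  - apply continuity_pt_filterlim, continuity_pt_div.
    + apply continuity_pt_opp, continuity_pt_filterlim, gam2_quotient_continuous_0.
    + apply continuity_pt_filterlim, gam_quotient_continuous_0.
    + rewrite gam_quotient_0. lra.
Qed.

(** Dividing r^2 G by r (gamma / r) leaves a factor r, so the extended ratio vanishes at both
    poles. *)
Lemma theta_ratio_flip (g : profile) (p : pole) (r : R) : 0 <= r < ell g ->
  cont_ext g (fun s => (Gam g s + dgam g 1 s) / gam g s) (flip g p r) =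
    orient p * (r * theta_quotient (local_profile g p) 0 r) / gam_quotient (local_profile g p) r.
Proof.
  intros Hr. apply (cont_ext_flip g p _ (fun r =>
    orient p * (r * theta_quotient (local_profile g p) 0 r) / gam_quotient (local_profile g p) r));
    [| |exact Hr].
  - intros s Hs. assert (Hs' : 0 <= s < ell (local_profile g p)) by (rewrite ell_local; lra).
    rewrite theta_coef_local, gam_local, gam_quotient_eq, theta_quotient_eq by lra.
    field. assert (H := gam_quotient_pos _ _ Hs'). lra.
  - apply continuity_pt_filterlim, continuity_pt_div.
    + apply continuity_pt_scal, continuity_pt_mult; [apply continuity_pt_id|].
      apply continuity_pt_filterlim, theta_quotient_continuous_0.
    + apply continuity_pt_filterlim, gam_quotient_continuous_0.
    + rewrite gam_quotient_0. lra.
Qed.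

Lemma area_local (g : profile) (p : pole) (x y : R) : in_chart g x y ->
  area g p x y = orient p * gam_quotient (local_profile g p) (radius x y).
Proof.
  intros Hxy. assert (H0 := radius_nonneg x y). unfold in_chart in Hxy. unfold area.
  destruct Req_EM_T as [->|Hne].
  - now rewrite gam_quotient_0.
  - rewrite gam_local, gam_quotient_eq by (rewrite ell_local; lra). field. exact Hne.
Qed.

(** The denominator gamma / r of the curvature cancels against the area density, which leaves an
    expression valid at the pole too. *)
Lemma curvature_area (g : profile) (p : pole) (x y : R) : in_chart g x y ->
  (1 - curv g (flip g p (radius x y))) * area g p x y =
  orient p * (gam_quotient (local_profile g p) (radius x y)
              + gam2_quotient (local_profile g p) (radius x y)).
Proof.
  intros Hxy. assert (H0 := radius_nonneg x y).
  rewrite area_local by assumption. unfold in_chart in Hxy. rewrite curv_flip by lra.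
  field. assert (H : 0 < gam_quotient (local_profile g p) (radius x y)); [|lra].
  apply gam_quotient_pos. rewrite ell_local. lra.
Qed.

(** * The form F dtheta in the two charts *)

(** The factor [orient p] is the sign in [theta_coef_local]: dtheta is the same in both charts,
    whereas F changes sign under reversal of the profile. *)
Definition canonical_x (g : profile) (p : pole) (x y : R) : R :=
  - orient p * (y * theta_quotient (local_profile g p) 0 (radius x y)).

Definition canonical_y (g : profile) (p : pole) (x y : R) : R :=
  orient p * (x * theta_quotient (local_profile g p) 0 (radius x y)).

Lemma radial_smooth_on_chart (g : profile) (f : R -> R -> R) :
  radial_poly (ell g) f -> smooth_on_chart g f.
Proof. intros Hf x y Hxy n. now apply (radial_poly_smooth (ell g)). Qed.

Lemma theta_quotient_radial (g : profile) (p : pole) :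
  radial_poly (ell g) (fun x y => theta_quotient (local_profile g p) 0 (radius x y)).
Proof. constructor. rewrite <- (ell_local g p). apply theta_quotient_even. Qed.

Lemma canonical_x_smooth (g : profile) (p : pole) : smooth_on_chart g (canonical_x g p).
Proof.
  apply radial_smooth_on_chart. unfold canonical_x.
  apply (radial_poly_mult _ (fun _ _ => - orient p)); [constructor|].
  apply (radial_poly_mult _ (fun _ y => y)); [constructor | apply theta_quotient_radial].
Qed.

Lemma canonical_y_smooth (g : profile) (p : pole) : smooth_on_chart g (canonical_y g p).
Proof.
  apply radial_smooth_on_chart. unfold canonical_y.
  apply (radial_poly_mult _ (fun _ _ => orient p)); [constructor|].
  apply (radial_poly_mult _ (fun x _ => x)); [constructor | apply theta_quotient_radial].
Qed.

Lemma canonical_polar (g : profile) (p : pole) (t th : R) : 0 < t < ell g ->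
  dt_comp g p (canonical_x g p) (canonical_y g p) t th = 0 /\
  dtheta_comp g p (canonical_x g p) (canonical_y g p) t th = Gam g t + dgam g 1 t.
Proof.
  intros Ht. assert (Hf := flip_bounds g p t Ht).
  assert (Hcs : cos th ^ 2 + sin th ^ 2 = 1).
  { generalize (sin2_cos2 th). unfold Rsqr. lra. }
  assert (Hc : Gam g t + dgam g 1 t =
    orient p * (flip g p t ^ 2 * theta_quotient (local_profile g p) 0 (flip g p t))).
  { rewrite <- theta_quotient_eq by (rewrite ell_local; lra).
    rewrite <- theta_coef_local, flip_flip by lra. reflexivity. }
  rewrite Hc. unfold dt_comp, dtheta_comp, canonical_x, canonical_y.
  rewrite radius_polar by lra. split.
  - ring.
  - transitivity (orient p * (flip g p t ^ 2 * theta_quotient (local_profile g p) 0 (flip g p t))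
      * (cos th ^ 2 + sin th ^ 2)); [ring | rewrite Hcs; ring].
Qed.

Lemma canonical_glue (g : profile) (t th : R) : 0 < t < ell g ->
  dt_comp g North (canonical_x g North) (canonical_y g North) t th =
    dt_comp g South (canonical_x g South) (canonical_y g South) t th /\
  dtheta_comp g North (canonical_x g North) (canonical_y g North) t th =
    dtheta_comp g South (canonical_x g South) (canonical_y g South) t th.
Proof.
  intros Ht. destruct (canonical_polar g North t th Ht) as [-> ->].
  destruct (canonical_polar g South t th Ht) as [-> ->]. split; reflexivity.
Qed.

Definition canonical_form (g : profile) : one_form g :=
  OneForm g (canonical_x g) (canonical_y g)
    (canonical_x_smooth g) (canonical_y_smooth g) (canonical_glue g).

Lemma canonical_dtheta (g : profile) :
  is_dtheta_form (canonical_form g) (fun t => Gam g t + dgam g 1 t).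
Proof. intros p t th Ht. now apply canonical_polar. Qed.

(** The exterior derivative of G (x dy - y dx) has coefficient 2 G + r G'. The partial derivatives
    of G are written x q and y q with q = G' / r, so the origin is no exception, and
    [theta_quotient_derivative] concludes. *)
Lemma canonical_primitive (g : profile) : is_primitive (canonical_form g).
Proof.
  intros p x y Hxy. rewrite curvature_area by assumption.
  assert (H0 := radius_nonneg x y). unfold in_chart in Hxy.
  assert (Hq := theta_quotient_even (local_profile g p)).
  assert (Hl : radius x y < ell (local_profile g p)) by now rewrite ell_local.
  rewrite <- theta_quotient_derivative by lra.
  rewrite <- (radial_quotient_eq _ _ _ Hq) by lra.
  set (q := radial_quotient (theta_quotient (local_profile g p)) 0 (radius x y)).
  set (G := theta_quotient (local_profile g p) 0 (radius x y)).
  assert (Hx : Derive (fun z => canonical_y g p z y) x = orient p * (G + x * (x * q))).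
  { apply is_derive_unique, (is_derive_scal (fun z => z * theta_quotient (local_profile g p) 0 (radius z y))).
    replace (G + x * (x * q)) with (1 * G + x * (x * q)) by ring.
    apply (is_derive_mult (fun z => z) (fun z => theta_quotient (local_profile g p) 0 (radius z y))).
    - apply (is_derive_id (K := R_AbsRing)).
    - now apply (is_derive_radial_x (ell (local_profile g p))).
    - apply Rmult_comm. }
  assert (Hy : Derive (fun z => canonical_x g p x z) y = - orient p * (G + y * (y * q))).
  { apply is_derive_unique, (is_derive_scal (fun z => z * theta_quotient (local_profile g p) 0 (radius x z))).
    replace (G + y * (y * q)) with (1 * G + y * (y * q)) by ring.
    apply (is_derive_mult (fun z => z) (fun z => theta_quotient (local_profile g p) 0 (radius x z))).
    - apply (is_derive_id (K := R_AbsRing)).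
    - now apply (is_derive_radial_y (ell (local_profile g p))).
    - apply Rmult_comm. }
  unfold ext_d. cbn [form_x form_y canonical_form]. rewrite Hx, Hy.
  transitivity (orient p * (2 * G + radius x y ^ 2 * q)); [rewrite radius_sqr; ring | ring].
Qed.

(** * Norms of covectors *)

Lemma gam_flip_pos (g : profile) (p : pole) (r : R) : 0 < r < ell g -> 0 < gam g (flip g p r).
Proof. intros Hr. apply gam_pos. now apply flip_bounds. Qed.

(** In the chart the field of theta-rotations is (- y, x), of length gamma; the vector tested here
    is its normalisation, of length exactly 1. *)
Lemma metric_angular (g : profile) (p : pole) (x y : R) :
  in_chart g x y -> radius x y <> 0 ->
  metric g p x y (- y / gam g (flip g p (radius x y))) (x / gam g (flip g p (radius x y))) <= 1.
Proof.
  intros Hxy Hne. assert (H0 := radius_nonneg x y). unfold in_chart in Hxy.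
  assert (Hg : 0 < gam g (flip g p (radius x y))) by (apply gam_flip_pos; lra).
  unfold metric. destruct Req_EM_T as [|_]; [contradiction|].
  set (c := gam g (flip g p (radius x y))) in *.
  apply Req_le.
  replace (x * (x / c) - y * (- y / c)) with ((x ^ 2 + y ^ 2) / c) by (field; lra).
  rewrite <- radius_sqr. field. lra.
Qed.

Lemma covector_norm_ge {g : profile} (b : one_form g) (p : pole) (x y : R) :
  in_chart g x y -> radius x y <> 0 ->
  Rbar_le (Rabs (x * form_y b p x y - y * form_x b p x y) / gam g (flip g p (radius x y)))
    (covector_norm b p x y).
Proof.
  intros Hxy Hne. assert (H0 := radius_nonneg x y).
  assert (Hm := metric_angular g p x y Hxy Hne). unfold in_chart in Hxy.
  assert (Hg : 0 < gam g (flip g p (radius x y))) by (apply gam_flip_pos; lra).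
  apply (proj1 (Lub_Rbar_correct _)). do 2 eexists. split; [exact Hm|].
  set (c := gam g (flip g p (radius x y))) in *.
  rewrite <- (Rabs_right c) at 1 by lra. rewrite <- Rabs_div by lra.
  f_equal. field. lra.
Qed.

Lemma covector_norm_nonneg {g : profile} (b : one_form g) (p : pole) (x y : R) :
  Rbar_le 0 (covector_norm b p x y).
Proof.
  apply (proj1 (Lub_Rbar_correct _)). exists 0, 0. split.
  - unfold metric, Rdiv. destruct Req_EM_T; ring_simplify; lra.
  - rewrite !Rmult_0_r, Rplus_0_r. symmetry. apply Rabs_R0.
Qed.

Lemma covector_norm_le {g : profile} (b : one_form g) (p : pole) (x y M : R) :
  (forall u v, metric g p x y u v <= 1 -> Rabs (form_x b p x y * u + form_y b p x y * v) <= M) ->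
  exists c, covector_norm b p x y = Finite c /\ c <= M.
Proof.
  intros H. assert (Hge := covector_norm_nonneg b p x y).
  assert (Hle : Rbar_le (covector_norm b p x y) M).
  { apply (proj2 (Lub_Rbar_correct _)). intros c (u & v & Huv & ->). now apply H. }
  destruct (covector_norm b p x y) as [c| |]; simpl in *;
    [now exists c | contradiction | contradiction].
Qed.

(** [form_norm] collects finite covector norms only, so finiteness is needed before a pointwise norm
    can be compared with it. *)
Lemma covector_norm_finite {g : profile} (b : one_form g) (p : pole) (x y : R) :
  in_chart g x y -> radius x y <> 0 -> exists c, covector_norm b p x y = Finite c.
Proof.
  intros Hxy Hne. assert (H0 := radius_nonneg x y). unfold in_chart in Hxy.
  assert (Hg : 0 < gam g (flip g p (radius x y))) by (apply gam_flip_pos; lra).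
  assert (Hr2 := radius_sqr x y).
  set (r := radius x y) in *. set (c := gam g (flip g p r)) in *.
  (* With radial part a and angular part w, the metric gives a^2 <= 1 and c^2 w^2 <= 1, while u^2 +
     v^2 = a^2 + r^2 w^2. Hence M bounds the Euclidean square. *)
  set (M := 1 + r ^ 2 / c ^ 2).
  destruct (covector_norm_le b p x y (Rabs (form_x b p x y) * M + Rabs (form_y b p x y) * M))
    as (d & Hd & _); [|now exists d].
  intros u v Huv. unfold metric in Huv. fold r in Huv. destruct Req_EM_T as [|_]; [contradiction|].
  fold c in Huv. set (a := (x * u + y * v) / r) in *. set (w := (x * v - y * u) / r ^ 2) in *.
  assert (Hnorm : u ^ 2 + v ^ 2 = a ^ 2 + r ^ 2 * w ^ 2).
  { unfold a, w. apply Rmult_eq_reg_l with (r ^ 2); [|nra].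
    transitivity ((x * u + y * v) ^ 2 + (x * v - y * u) ^ 2); [rewrite Hr2; ring | field; exact Hne]. }
  assert (Hc2 : 0 < c ^ 2) by nra.
  assert (Ha2 := pow2_ge_0 a). assert (Hw2 := pow2_ge_0 w). assert (Hrr := pow2_ge_0 r).
  assert (Hw : r ^ 2 * w ^ 2 <= r ^ 2 / c ^ 2).
  { apply Rmult_le_compat_l; [exact Hrr|]. apply Rmult_le_reg_l with (c ^ 2); [exact Hc2|].
    rewrite Rinv_r by lra. lra. }
  assert (Ha : a ^ 2 <= 1) by (assert (0 <= c ^ 2 * w ^ 2) by (apply Rmult_le_pos; lra); lra).
  assert (HM : u ^ 2 + v ^ 2 <= M) by (unfold M; lra).
  assert (HM1 : 1 <= M).
  { unfold M. assert (0 <= r ^ 2 / c ^ 2); [|lra].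
    apply Rmult_le_pos; [exact Hrr|]. left. now apply Rinv_0_lt_compat. }
  (* Since M >= 1, a square bounded by M has a root bounded by M. *)
  assert (Hbd : forall z, z ^ 2 <= M -> Rabs z <= M).
  { intros z Hz. apply Rabs_le. nra. }
  assert (Hu2 := pow2_ge_0 u). assert (Hv2 := pow2_ge_0 v).
  eapply Rle_trans; [apply Rabs_triang|]. rewrite !Rabs_mult.
  apply Rplus_le_compat; (apply Rmult_le_compat_l; [apply Rabs_pos|]); apply Hbd; lra.
Qed.

(** The form annihilates the radial direction, so the angular term of the metric alone bounds the
    pairing, and the unit angular vector attains the bound. At a pole both sides are 0. *)
Lemma canonical_covector_norm (g : profile) (p : pole) (x y : R) : in_chart g x y ->
  covector_norm (canonical_form g) p x y = Finite (Rabs (cont_ext g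
    (fun s => (Gam g s + dgam g 1 s) / gam g s) (flip g p (radius x y)))).
Proof.
  intros Hxy. assert (H0 := radius_nonneg x y).
  assert (Hr : 0 <= radius x y < ell g) by now split.
  rewrite theta_ratio_flip by assumption.
  assert (HB : 0 < gam_quotient (local_profile g p) (radius x y))
    by (apply gam_quotient_pos; now rewrite ell_local).
  assert (Hg : gam g (flip g p (radius x y)) = radius x y * gam_quotient (local_profile g p) (radius x y)).
  { rewrite gam_local. apply gam_quotient_eq. now rewrite ell_local. }
  assert (Hr2 := radius_sqr x y).
  assert (Hge := covector_norm_ge (canonical_form g) p x y Hxy).
  assert (Hval : forall u v, form_x (canonical_form g) p x y * u + form_y (canonical_form g) p x y * v
    = orient p * theta_quotient (local_profile g p) 0 (radius x y) * (x * v - y * u)).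
  { intros u v. simpl. unfold canonical_x, canonical_y. ring. }
  cbn [form_x form_y canonical_form] in Hge. unfold canonical_x, canonical_y in Hge.
  set (G := theta_quotient (local_profile g p) 0 (radius x y)) in *.
  set (B := gam_quotient (local_profile g p) (radius x y)) in *.
  set (M := Rabs (orient p * (radius x y * G) / B)).
  destruct (covector_norm_le (canonical_form g) p x y M) as (c & Hc & HcM).
  { intros u v Huv. rewrite Hval. destruct (Req_dec (radius x y) 0) as [Hz|Hz].
    - destruct (radius_eq0 _ _ Hz) as [-> ->].
      rewrite !Rmult_0_l, Rminus_0_r, Rmult_0_r, Rabs_R0. apply Rabs_pos.
    - unfold metric in Huv. destruct Req_EM_T as [|_]; [contradiction|]. rewrite Hg in Huv.
      set (r := radius x y) in *.
      assert (Hw : ((x * v - y * u) * (B / r)) ^ 2 <= 1).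
      { eapply Rle_trans; [|exact Huv].
        replace ((r * B) ^ 2 * ((x * v - y * u) / r ^ 2) ^ 2)
          with (((x * v - y * u) * (B / r)) ^ 2) by (field; exact Hz).
        generalize (pow2_ge_0 ((x * u + y * v) / r)). lra. }
      replace (orient p * G * (x * v - y * u))
        with (orient p * (r * G) / B * ((x * v - y * u) * (B / r))) by (field; lra).
      rewrite Rabs_mult. fold M. rewrite <- (Rmult_1_r M) at 2.
      apply Rmult_le_compat_l; [apply Rabs_pos|]. apply Rabs_le. nra. }
  rewrite Hc. f_equal. apply Rle_antisym; [exact HcM|].
  destruct (Req_dec (radius x y) 0) as [Hz|Hz].
  - assert (Hnn := covector_norm_nonneg (canonical_form g) p x y). rewrite Hc in Hnn.
    unfold M. rewrite Hz. unfold Rdiv. rewrite Rmult_0_l, Rmult_0_r, Rmult_0_l, Rabs_R0. exact Hnn.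
  - specialize (Hge Hz). rewrite Hc, Hg in Hge. simpl in Hge.
    eapply Rle_trans; [|exact Hge]. apply Req_le.
    replace (x * (orient p * (x * G)) - y * (- orient p * (y * G)))
      with (orient p * (radius x y * G) / B * (radius x y * B)).
    + rewrite Rabs_mult, (Rabs_right (radius x y * B)) by nra. fold M. field. lra.
    + transitivity (orient p * G * radius x y ^ 2); [field; lra | rewrite Hr2; ring].
Qed.

Lemma canonical_form_norm (g : profile) :
  form_norm (canonical_form g) =
    Lub_Rbar (fun c => exists t : R, 0 <= t <= ell g /\
      c = Rabs (cont_ext g (fun s => (Gam g s + dgam g 1 s) / gam g s) t)).
Proof.
  assert (Hl := ell_pos g).
  apply Lub_Rbar_eqset. intros c. split.
  - intros (p & x & y & Hxy & Hc). rewrite canonical_covector_norm in Hc by assumption.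
    injection Hc as <-. exists (flip g p (radius x y)). split; [|reflexivity].
    assert (H0 := radius_nonneg x y). unfold in_chart in Hxy. destruct p; simpl; lra.
  - intros (t & Ht & ->).
    (* The chart around [North] misses only t = ell, which is the origin of the other chart. *)
    assert (Hp : exists p r, 0 <= r < ell g /\ t = flip g p r).
    { destruct (Req_dec t (ell g)) as [->|Hne].
      - exists South, 0. split; [lra | simpl; ring].
      - exists North, t. split; [lra | reflexivity]. }
    destruct Hp as (p & r & Hr & ->).
    assert (Hrr : radius r 0 = r) by (rewrite radius_abs; apply Rabs_right; lra).
    exists p, r, 0. unfold in_chart. rewrite Hrr. split; [lra|].
    rewrite canonical_covector_norm by (unfold in_chart; rewrite Hrr; lra). now rewrite Hrr.
Qed.

(** * Polar coordinates and Stokes' theorem *)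

(** Negative r is allowed, so that derivatives in r are two-sided at r = 0 as well. *)
Lemma in_chart_polar (g : profile) (r th : R) :
  - ell g < r < ell g -> in_chart g (r * cos th) (r * sin th).
Proof.
  intros Hr. unfold in_chart, radius.
  replace ((r * cos th) ^ 2 + (r * sin th) ^ 2) with (Rsqr r * (Rsqr (sin th) + Rsqr (cos th)))
    by (unfold Rsqr; ring).
  rewrite sin2_cos2, Rmult_1_r, sqrt_Rsqr_abs. apply Rabs_def1; lra.
Qed.

(** The chain rule in polar coordinates needs total differentiability, which follows from the
    existence of both partial derivatives and the continuity of one of them. *)
Lemma smooth_differentiable (g : profile) (f : R -> R -> R) (x y : R) :
  smooth_on_chart g f -> in_chart g x y ->
  differentiable_pt_lim f x y (Derive (fun z => f z y) x) (Derive (fun z => f x z) y).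
Proof.
  intros Hf Hxy. apply filterdiff_differentiable_pt_lim.
  destruct (Hf x y Hxy 1%nat) as (_ & _ & Hy & [Hfx _] & _).
  apply (is_derive_filterdiff f x y (fun u v => Derive (fun z => f z v) u)).
  - generalize (proj1 (locally_2d_locally _ _ _) (locally_2d_radius _ _ _ Hxy)).
    apply filter_imp. intros [u v] Huv. simpl in *. apply Derive_correct.
    now destruct (Hf u v Huv 1%nat) as (_ & H & _).
  - now apply Derive_correct.
  - now apply continuity_2d_pt_filterlim in Hfx.
Qed.

Lemma is_derive_polar_r (g : profile) (f : R -> R -> R) (r th : R) :
  smooth_on_chart g f -> - ell g < r < ell g ->
  is_derive (fun u => f (u * cos th) (u * sin th)) r
    (Derive (fun z => f z (r * sin th)) (r * cos th) * cos th +
     Derive (fun z => f (r * cos th) z) (r * sin th) * sin th).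
Proof.
  intros Hf Hr. apply is_derive_Reals.
  apply (derivable_pt_lim_comp_2d f (fun u => u * cos th) (fun u => u * sin th)).
  - now apply (smooth_differentiable g), in_chart_polar.
  - apply is_derive_Reals. auto_derive; [trivial | ring].
  - apply is_derive_Reals. auto_derive; [trivial | ring].
Qed.

Lemma is_derive_polar_th (g : profile) (f : R -> R -> R) (r th : R) :
  smooth_on_chart g f -> - ell g < r < ell g ->
  is_derive (fun t => f (r * cos t) (r * sin t)) th
    (Derive (fun z => f z (r * sin th)) (r * cos th) * (- r * sin th) +
     Derive (fun z => f (r * cos th) z) (r * sin th) * (r * cos th)).
Proof.
  intros Hf Hr. apply is_derive_Reals.
  apply (derivable_pt_lim_comp_2d f (fun t => r * cos t) (fun t => r * sin t)).
  - now apply (smooth_differentiable g), in_chart_polar.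
  - apply is_derive_Reals. auto_derive; [trivial | ring].
  - apply is_derive_Reals. auto_derive; [trivial | ring].
Qed.

Lemma continuity_2d_cos (r th : R) : continuity_2d_pt (fun _ v => cos v) r th.
Proof.
  apply (continuity_2d_pt_comp_1d cos (fun _ v => v)); [apply continuous_cos | apply continuity_2d_pt_id2].
Qed.

Lemma continuity_2d_sin (r th : R) : continuity_2d_pt (fun _ v => sin v) r th.
Proof.
  apply (continuity_2d_pt_comp_1d sin (fun _ v => v)); [apply continuous_sin | apply continuity_2d_pt_id2].
Qed.

Lemma continuity_2d_polar (f : R -> R -> R) (r th : R) :
  continuity_2d_pt f (r * cos th) (r * sin th) ->
  continuity_2d_pt (fun u v => f (u * cos v) (u * sin v)) r th.
Proof.
  apply (continuity_2d_pt_comp f (fun u v => u * cos v) (fun u v => u * sin v));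
    apply continuity_2d_pt_mult;
    apply continuity_2d_pt_id1 || apply continuity_2d_cos || apply continuity_2d_sin.
Qed.

(* Derivative in [r] of the dtheta-component [r (Q cos th - P sin th)]. *)
Definition dr_dtheta_comp (P Q : R -> R -> R) (r th : R) : R :=
  let x := r * cos th in
  let y := r * sin th in
  (Q x y * cos th - P x y * sin th) +
  r * ((Derive (fun z => Q z y) x * cos th + Derive (fun z => Q x z) y * sin th) * cos th
       - (Derive (fun z => P z y) x * cos th + Derive (fun z => P x z) y * sin th) * sin th).

Lemma is_derive_dtheta_comp (g : profile) (P Q : R -> R -> R) (r th : R) :
  smooth_on_chart g P -> smooth_on_chart g Q -> - ell g < r < ell g ->
  is_derive (fun u => dtheta_comp g North P Q u th) r (dr_dtheta_comp P Q r th).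
Proof.
  intros HP HQ Hr. unfold dtheta_comp, dr_dtheta_comp; simpl.
  rewrite <- (Rmult_1_l (Q _ _ * _ - _)).
  apply (is_derive_mult (fun u => u)
    (fun u => Q (u * cos th) (u * sin th) * cos th - P (u * cos th) (u * sin th) * sin th)).
  - apply (is_derive_id (K := R_AbsRing)).
  - apply (is_derive_minus (V := R_NormedModule)
      (fun u => Q (u * cos th) (u * sin th) * cos th) (fun u => P (u * cos th) (u * sin th) * sin th)).
    + apply (is_derive_scal_l (V := R_NormedModule) (fun u => Q (u * cos th) (u * sin th))).
      now apply (is_derive_polar_r g).
    + apply (is_derive_scal_l (V := R_NormedModule) (fun u => P (u * cos th) (u * sin th))).
      now apply (is_derive_polar_r g).
  - apply Rmult_comm.
Qed.

Lemma continuity_dr_dtheta_comp (g : profile) (P Q : R -> R -> R) (r th : R) :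
  smooth_on_chart g P -> smooth_on_chart g Q -> - ell g < r < ell g ->
  continuity_2d_pt (dr_dtheta_comp P Q) r th.
Proof.
  intros HP HQ Hr. assert (Hin := in_chart_polar g r th Hr).
  destruct (HP _ _ Hin 1%nat) as (HP0 & _ & _ & [HPx _] & [HPy _]).
  destruct (HQ _ _ Hin 1%nat) as (HQ0 & _ & _ & [HQx _] & [HQy _]).
  apply continuity_2d_polar in HP0, HPx, HPy, HQ0, HQx, HQy.
  unfold dr_dtheta_comp.
  repeat first [ assumption | apply continuity_2d_pt_plus | apply continuity_2d_pt_opp
    | apply continuity_2d_pt_mult | apply continuity_2d_pt_id1
    | apply continuity_2d_cos | apply continuity_2d_sin ].
Qed.

(* On the circle of radius [r], this differs from the theta-derivative of the
   dr-component by [r] times the exterior derivative, which is constant there. *)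
Lemma RInt_dr_dtheta_comp (g : profile) (b : one_form g) (r : R) :
  is_primitive b -> 0 <= r < ell g ->
  is_RInt (dr_dtheta_comp (form_x b North) (form_y b North) r) 0 (2 * PI)
    (2 * PI * theta_coef g 1 r).
Proof.
  intros Hb Hr. assert (Hr' : - ell g < r < ell g) by lra.
  set (P := form_x b North). set (Q := form_y b North).
  assert (HP : smooth_on_chart g P) by apply form_x_smooth.
  assert (HQ : smooth_on_chart g Q) by apply form_y_smooth.
  set (e := theta_coef g 1 r).
  (* By rotational symmetry of (1 - K) mu, r times its density is gamma + gamma'' = F'(r) all around
     the circle. *)
  assert (He : forall th, r * ext_d b North (r * cos th) (r * sin th) = e).
  { intros th. rewrite (Hb North) by now apply in_chart_polar.
    rewrite curvature_area by now apply in_chart_polar.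
    rewrite radius_polar by lra. unfold e. simpl orient. cbn [theta_coef local_profile].
    rewrite !odd_ext_nonneg by lra.
    change (dgam g 0 r) with (gam g r). rewrite gam_quotient_eq, gam2_quotient_eq by assumption.
    ring. }
  assert (HdT : is_RInt (fun th => dr_dtheta_comp P Q r th - e) 0 (2 * PI) 0).
  (* T is the dr-component of the form; being 2 pi-periodic, its theta-derivative has integral 0. *)
  { pose (T := fun th => P (r * cos th) (r * sin th) * cos th + Q (r * cos th) (r * sin th) * sin th).
    replace 0 with (minus (T (2 * PI)) (T 0)) at 2.
    2: { unfold T, minus, plus, opp; simpl. rewrite cos_2PI, sin_2PI, cos_0, sin_0. ring. }
    apply (is_RInt_derive (V := R_CompleteNormedModule) T).
    - intros th _. rewrite <- (He th). unfold ext_d, dr_dtheta_comp. fold P Q.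
      set (x := r * cos th). set (y := r * sin th).
      evar_last.
      + apply (is_derive_plus (V := R_NormedModule));
          apply (is_derive_mult (fun t => _ (r * cos t) (r * sin t)));
          [ apply (is_derive_polar_th g _ _ _ HP Hr') | apply is_derive_Reals, derivable_pt_lim_cos
          | apply Rmult_comm
          | apply (is_derive_polar_th g _ _ _ HQ Hr') | apply is_derive_Reals, derivable_pt_lim_sin
          | apply Rmult_comm ].
      + unfold plus, mult; simpl. fold x y.
        set (Px := Derive (fun z => P z y) x). set (Py := Derive (fun z => P x z) y).
        set (Qx := Derive (fun z => Q z y) x). set (Qy := Derive (fun z => Q x z) y).
        assert (Hcs : r * (Qx - Py) = r * (Qx - Py) * (Rsqr (sin th) + Rsqr (cos th)))
          by (rewrite sin2_cos2; ring).
        rewrite Hcs. set (P0 := P x y). set (Q0 := Q x y). unfold x, Rsqr. ring.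
    - intros th _. apply (continuous_minus (V := R_NormedModule)); [|apply continuous_const].
      apply continuity_2d_pt_section. now apply (continuity_dr_dtheta_comp g). }
  replace (2 * PI * e) with (plus 0 (scal (2 * PI - 0) e))
    by (unfold plus, scal; simpl; unfold mult; simpl; ring).
  apply (is_RInt_ext (V := R_NormedModule)) with (fun th => plus (dr_dtheta_comp P Q r th - e) e).
  - intros th _. unfold plus; simpl. ring.
  - apply (is_RInt_plus (V := R_NormedModule)); [exact HdT | apply (is_RInt_const (V := R_NormedModule))].
Qed.

Lemma ex_RInt_dtheta_comp (g : profile) (P Q : R -> R -> R) (r : R) :
  smooth_on_chart g P -> smooth_on_chart g Q -> - ell g < r < ell g ->
  ex_RInt (fun th => dtheta_comp g North P Q r th) 0 (2 * PI).
Proof.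
  intros HP HQ Hr. apply (ex_RInt_continuous (V := R_CompleteNormedModule)). intros th _.
  apply continuity_2d_pt_section. assert (Hin := in_chart_polar g r th Hr).
  destruct (HP _ _ Hin 0%nat) as [HP0 _]. destruct (HQ _ _ Hin 0%nat) as [HQ0 _].
  apply continuity_2d_polar in HP0, HQ0. unfold dtheta_comp; simpl.
  repeat first [ assumption | apply continuity_2d_pt_minus | apply continuity_2d_pt_mult
    | apply continuity_2d_pt_id1 | apply continuity_2d_cos | apply continuity_2d_sin ].
Qed.

(* Stokes' theorem on the disc of radius [t], by differentiating in [t]. *)
Lemma primitive_circulation (g : profile) (b : one_form g) (t : R) :
  is_primitive b -> 0 < t < ell g ->
  RInt (fun th => dtheta_comp g North (form_x b North) (form_y b North) t th) 0 (2 * PI) =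
  2 * PI * (Gam g t + dgam g 1 t).
Proof.
  intros Hb Ht. assert (Hl := ell_pos g).
  set (P := form_x b North). set (Q := form_y b North).
  assert (HP : smooth_on_chart g P) by apply form_x_smooth.
  assert (HQ : smooth_on_chart g Q) by apply form_y_smooth.
  pose (J := fun r => RInt (fun th => dtheta_comp g North P Q r th) 0 (2 * PI)).
  (* The circulation J and 2 pi F have the same derivative, and both vanish at r = 0, where the
     circle shrinks to the pole. Hence D is identically 0. *)
  pose (D := fun r => J r - 2 * PI * theta_coef g 0 r).
  assert (HJ : forall r, 0 <= r < ell g -> is_derive J r (2 * PI * theta_coef g 1 r)).
  { intros r Hr. assert (Hr' : - ell g < r < ell g) by lra.
    assert (HD : forall u v, - ell g < u < ell g ->
      Derive (fun z => dtheta_comp g North P Q z v) u = dr_dtheta_comp P Q u v).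
    { intros u v Hu. apply is_derive_unique. now apply is_derive_dtheta_comp. }
    rewrite <- (is_RInt_unique (V := R_CompleteNormedModule) _ _ _ _ (RInt_dr_dtheta_comp g b r Hb Hr)).
    rewrite <- (RInt_ext (V := R_CompleteNormedModule) (fun th => Derive (fun u => dtheta_comp g North P Q u th) r))
      by (intros; now apply HD).
    apply (is_derive_RInt_param (fun r th => dtheta_comp g North P Q r th)).
    - generalize (locally_Ioo _ _ _ Hr'). apply filter_imp. intros u Hu th _.
      eexists. now apply is_derive_dtheta_comp.
    - intros th _. apply continuity_2d_pt_ext_loc with (dr_dtheta_comp P Q).
      + generalize (locally_2d_Ioo (fun u _ => u) _ _ r th (continuity_2d_pt_id1 r th) Hr').
        apply locally_2d_impl, locally_2d_forall. intros u v Hu. symmetry. now apply HD.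
      + now apply (continuity_dr_dtheta_comp g).
    - generalize (locally_Ioo _ _ _ Hr'). apply filter_imp. intros u Hu.
      now apply ex_RInt_dtheta_comp. }
  assert (HD0 : D 0 = 0).
  { unfold D, J. rewrite theta_coef_0.
    rewrite (RInt_ext (V := R_CompleteNormedModule) _ (fun _ => 0)).
    - rewrite RInt_const. unfold scal; simpl; unfold mult; simpl. ring.
    - intros th _. unfold dtheta_comp; simpl. ring. }
  assert (HDt : D 0 = D t).
  { apply (eq_is_derive (V := R_NormedModule) D); [|lra]. intros s Hs.
    replace (zero : R_NormedModule) with (2 * PI * theta_coef g 1 s - 2 * PI * theta_coef g 1 s)
      by (unfold zero; simpl; ring).
    apply (is_derive_minus (V := R_NormedModule) J (fun r => 2 * PI * theta_coef g 0 r)).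
    - apply HJ. lra.
    - apply is_derive_scal, theta_coef_derivatives. lra. }
  rewrite HD0 in HDt. unfold D, J in HDt. rewrite <- theta_coef_eq by lra. lra.
Qed.

(** * Uniqueness of a form with given polar components *)

Lemma polar_angle (x y : R) : 0 < radius x y ->
  exists th, x = radius x y * cos th /\ y = radius x y * sin th.
Proof.
  intros Hr. assert (H2 := radius_sqr x y). set (r := radius x y) in *.
  assert (Hc : -1 <= x / r <= 1).
  { apply Rabs_le_between. rewrite Rabs_div by lra. rewrite (Rabs_right r) by lra.
    apply Rmult_le_reg_r with r; [exact Hr|]. unfold Rdiv. rewrite Rmult_assoc, Rinv_l by lra.
    rewrite Rmult_1_r, Rmult_1_l. apply Rabs_le. nra. }
  assert (Hcos := cos_acos _ Hc). assert (Hsin := sin_acos _ Hc).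
  replace (1 - (x / r)²) with (Rsqr (y / r)) in Hsin.
  2: { unfold Rsqr. apply Rmult_eq_reg_l with (r ^ 2); [|nra].
       transitivity (y ^ 2); [field; lra|]. transitivity (r ^ 2 - x ^ 2); [rewrite H2; ring | field; lra]. }
  rewrite sqrt_Rsqr_abs, Rabs_div, (Rabs_right r) in Hsin by lra.
  (* [acos] gives an angle with nonnegative sine; its opposite serves the lower half-plane. *)
  destruct (Rle_dec 0 y) as [Hy|Hy].
  - exists (acos (x / r)). rewrite Hcos, Hsin, Rabs_right by lra. split; field; lra.
  - exists (- acos (x / r)). rewrite cos_neg, sin_neg, Hcos, Hsin, Rabs_left by lra.
    split; field; lra.
Qed.

(** Away from the poles the polar components determine the Cartesian ones by a rotation. Polar
    coordinates degenerate at a pole, where continuity of the coefficients decides. *)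
Lemma dtheta_form_unique (g : profile) (b b' : one_form g) (f : R -> R) :
  is_dtheta_form b f -> is_dtheta_form b' f -> form_eq b' b.
Proof.
  intros Hb Hb'. assert (Hl := ell_pos g).
  assert (Hoff : forall p x y, in_chart g x y -> radius x y <> 0 ->
    form_x b' p x y = form_x b p x y /\ form_y b' p x y = form_y b p x y).
  { intros p x y Hxy Hne. assert (H0 := radius_nonneg x y). unfold in_chart in Hxy.
    assert (Hr : 0 < radius x y) by lra.
    destruct (polar_angle x y Hr) as (th & Hx & Hy). set (r := radius x y) in *.
    assert (Ht := flip_bounds g p r (conj Hr Hxy)).
    destruct (Hb p _ th Ht) as [H1 H2]. destruct (Hb' p _ th Ht) as [H3 H4].
    rewrite <- H2 in H4. clear H2. unfold dt_comp, dtheta_comp in *.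
    rewrite flip_flip, <- Hx, <- Hy in *.
    assert (Hcs : Rsqr (sin th) + Rsqr (cos th) = 1) by apply sin2_cos2. unfold Rsqr in Hcs.
    set (c := cos th) in *. set (s := sin th) in *.
    set (A := form_x b p x y) in *. set (B := form_y b p x y) in *.
    set (A' := form_x b' p x y) in *. set (B' := form_y b' p x y) in *.
    apply Rmult_eq_reg_l in H4; [|lra].
    assert (H5 : (A' * c + B' * s) = (A * c + B * s)).
    { destruct p; simpl in H1, H3; lra. }
    split.
    - transitivity (A' * (s * s + c * c)); [rewrite Hcs; ring|].
      transitivity ((A' * c + B' * s) * c - (B' * c - A' * s) * s); [ring|].
      rewrite H5, H4. transitivity (A * (s * s + c * c)); [ring | rewrite Hcs; ring].
    - transitivity (B' * (s * s + c * c)); [rewrite Hcs; ring|].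
      transitivity ((A' * c + B' * s) * s + (B' * c - A' * s) * c); [ring|].
      rewrite H5, H4. transitivity (B * (s * s + c * c)); [ring | rewrite Hcs; ring]. }
  assert (Hext : forall h k : R -> R -> R, smooth_on_chart g h -> smooth_on_chart g k ->
    (forall x y, in_chart g x y -> radius x y <> 0 -> h x y = k x y) -> h 0 0 = k 0 0).
  { intros h k Hh Hk Hhk.
    assert (Hin : in_chart g 0 0) by (unfold in_chart; rewrite radius_0; lra).
    assert (Hcont : continuity_2d_pt (fun x y => h x y - k x y) 0 0).
    { apply continuity_2d_pt_minus; [apply (Hh _ _ Hin 0%nat) | apply (Hk _ _ Hin 0%nat)]. }
    destruct (Req_dec (h 0 0 - k 0 0) 0) as [|Hne]; [lra|]. exfalso.
    (* The gap at the origin serves as epsilon: at the nearby point (u, 0) the difference is 0, so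
       its distance to the gap is not smaller than epsilon. *)
    destruct (Hcont (mkposreal _ (Rabs_pos_lt _ Hne))) as [d Hd]. simpl in Hd.
    assert (Hd0 := cond_pos d). set (u := Rmin (d / 2) (ell g / 2)).
    assert (Hu : 0 < u) by (apply Rmin_pos; lra).
    assert (Hu1 : u <= d / 2) by apply Rmin_l. assert (Hu2 : u <= ell g / 2) by apply Rmin_r.
    assert (Hru : radius u 0 = u) by (rewrite radius_abs; apply Rabs_right; lra).
    specialize (Hd u 0). rewrite !Rminus_0_r, Rabs_R0, (Rabs_right u) in Hd by lra.
    assert (Hlt := Hd ltac:(lra) ltac:(lra)).
    rewrite (Hhk u 0) in Hlt by (unfold in_chart; rewrite ?Hru; lra).
    rewrite Rminus_diag, Rminus_0_l, Rabs_Ropp in Hlt. lra. }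
  intros p x y Hxy. destruct (Req_dec (radius x y) 0) as [Hz|Hz].
  - destruct (radius_eq0 _ _ Hz) as [-> ->]. split.
    + apply Hext; [apply form_x_smooth | apply form_x_smooth |]. intros u v Huv Hne. now apply Hoff.
    + apply Hext; [apply form_y_smooth | apply form_y_smooth |]. intros u v Huv Hne. now apply Hoff.
  - now apply Hoff.
Qed.

(** * Minimality of the norm and the theorem *)

(** On the circle at t the theta-component of b is at most c gamma(t) in absolute value. Integrating
    this and inserting the circulation gives 2 pi |F(t)| <= 2 pi c gamma(t). *)
Lemma canonical_norm_minimal (g : profile) (b : one_form g) (c : R) :
  is_primitive b -> form_norm b = Finite c -> Rbar_le (form_norm (canonical_form g)) c.
Proof.
  intros Hb Hc. assert (Hl := ell_pos g).
  assert (Hle : forall t, 0 < t < ell g -> Rabs ((Gam g t + dgam g 1 t) / gam g t) <= c).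
  { intros t Ht. assert (Hg := gam_pos g t Ht). change (dgam g 0 t) with (gam g t) in Hg.
    assert (HPI := PI_RGT_0). assert (Ht' : - ell g < t < ell g) by lra.
    assert (Hpt : forall th, Rabs (dtheta_comp g North (form_x b North) (form_y b North) t th) <= c * gam g t).
    { intros th. set (x := t * cos th). set (y := t * sin th).
      assert (Hin : in_chart g x y) by now apply in_chart_polar.
      assert (Hr : radius x y = t) by (apply radius_polar; lra).
      assert (Hne : radius x y <> 0) by lra.
      assert (Hge := covector_norm_ge b North x y Hin Hne).
      destruct (covector_norm_finite b North x y Hin Hne) as [d Hd].
      assert (Hdc : Rbar_le d (form_norm b)).
      { apply (proj1 (Lub_Rbar_correct _)). now exists North, x, y. }
      rewrite Hd, Hr in Hge. rewrite Hc in Hdc. simpl in Hge, Hdc.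
      apply Rmult_le_reg_r with (/ gam g t); [now apply Rinv_0_lt_compat|].
      rewrite Rmult_assoc, Rinv_r, Rmult_1_r by lra.
      eapply Rle_trans; [|exact Hdc]. eapply Rle_trans; [|exact Hge].
      apply Req_le. unfold Rdiv. do 2 f_equal. unfold dtheta_comp; simpl. fold x y.
      set (P0 := form_x b North x y). set (Q0 := form_y b North x y). unfold x, y. ring. }
    assert (Hint := primitive_circulation g b t Hb Ht).
    assert (Habs := abs_RInt_le_const
      (fun th => dtheta_comp g North (form_x b North) (form_y b North) t th) 0 (2 * PI) (c * gam g t)
      ltac:(lra) (ex_RInt_dtheta_comp g _ _ t (form_x_smooth g b North) (form_y_smooth g b North) Ht')
      (fun th _ => Hpt th)).
    rewrite Hint, Rabs_mult, Rabs_right, Rminus_0_r in Habs by lra.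
    apply Rmult_le_reg_l in Habs; [|lra].
    rewrite Rabs_div, (Rabs_right (gam g t)) by lra.
    apply Rmult_le_reg_r with (gam g t); [exact Hg|]. unfold Rdiv.
    rewrite Rmult_assoc, Rinv_l by lra. lra. }
  apply (proj2 (Lub_Rbar_correct _)). intros d (p & x & y & Hxy & Hd).
  rewrite canonical_covector_norm in Hd by assumption. injection Hd as <-.
  assert (H0 := radius_nonneg x y). unfold in_chart in Hxy.
  destruct (Req_dec (radius x y) 0) as [Hz|Hz].
  (* At a pole the ratio is 0, and c >= 0 because it bounds an absolute value at some interior
     point, here the middle one. *)
  - rewrite theta_ratio_flip, Hz by lra. unfold Rdiv. rewrite Rmult_0_l, Rmult_0_r, Rmult_0_l, Rabs_R0.
    simpl. eapply Rle_trans; [apply Rabs_pos | apply (Hle (ell g / 2)); lra].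
  - assert (Ht : 0 < flip g p (radius x y) < ell g) by (apply flip_bounds; lra).
    unfold cont_ext. do 2 (destruct Rle_dec as [|_]; [lra|]). simpl. now apply Hle.
Qed.

Lemma canonical_attains_m_inf (g : profile) : m_inf g = form_norm (canonical_form g).
Proof.
  apply is_glb_Rbar_unique. split.
  - intros c (b & Hb & Hc). now apply (canonical_norm_minimal g b).
  - (* If the norm is infinite there is no competitor, by minimality, and the
       infimum is that of the empty set. *)
    intros l Hl.
    (* A point of the surface is exhibited, so the supremum is not that of an empty set and cannot
       be minus infinity. *)
    assert (Hge : Rbar_le 0 (form_norm (canonical_form g))).
    { assert (H0 : in_chart g 0 0) by (unfold in_chart; rewrite radius_0; apply ell_pos).
      eapply Rbar_le_trans; [|apply (proj1 (Lub_Rbar_correct _)); exists North, 0, 0; split;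
        [exact H0 | now apply canonical_covector_norm]].
      apply Rabs_pos. }
    destruct (form_norm (canonical_form g)) as [c| |] eqn:Hc.
    + apply Hl. exists (canonical_form g). split; [apply canonical_primitive | exact Hc].
    + now destruct l.
    + contradiction.
Qed.

Theorem proposition5p5 : forall g : profile,
  exists b : one_form g,
    (is_primitive b /\ exists f : R -> R, is_dtheta_form b f) /\
    (forall b' : one_form g,
       (is_primitive b' /\ exists f : R -> R, is_dtheta_form b' f) ->
       form_eq b' b) /\
    m_inf g = form_norm b /\
    is_dtheta_form b (fun t => Gam g t + dgam g 1 t) /\
    form_norm b =
      Lub_Rbar (fun c => exists t : R, 0 <= t <= ell g /\
        c = Rabs (cont_ext g (fun s => (Gam g s + dgam g 1 s) / gam g s) t)).
Proof.
  intros g. exists (canonical_form g).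
  split; [split; [apply canonical_primitive | eexists; apply canonical_dtheta]|].
  split; [|split; [apply canonical_attains_m_inf|
    split; [apply canonical_dtheta | apply canonical_form_norm]]].
  intros b' (Hb' & f & Hf).
  apply dtheta_form_unique with (fun t => Gam g t + dgam g 1 t); [apply canonical_dtheta|].
  intros p t th Ht. destruct (Hf p t th Ht) as [H1 ->]. split; [exact H1|].
  assert (HPI := PI_RGT_0). assert (Hint := primitive_circulation g b' t Hb' Ht).
  rewrite (RInt_ext (V := R_CompleteNormedModule) _ (fun _ => f t)), RInt_const in Hint
    by (intros; now apply Hf).
  unfold scal in Hint; simpl in Hint; unfold mult in Hint; simpl in Hint.
  apply Rmult_eq_reg_l with (2 * PI); lra.
Qed.
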